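(* There are constants $c_1,c_2>0$ such that for all $k\in\mathbb{N}$, $$c_1\,\Gamma(2k+1)\leq\int_0^1 g(x)^{2k}\,dx\leq c_2\,\Gamma(2k+1),$$ where $\Gamma$ is the Gamma function and $g(x)=\sum_{l\geq 1}\frac{1-2\{lx\}}{l}$.
   Context: $\{y\}$ denotes the fractional part of the real number $y$. The function $g$ is defined (almost everywhere on $(0,1)$) as the sum of the series $g(x)=\sum_{l\ge 1}\frac{1-2\{lx\}}{l}=\lim_{N\to\infty}\sum_{l=1}^{N}\frac{1-2\{lx\}}{l}$, which converges for almost every $x$. $\mathbb{N}=\{1,2,3,\dots\}$. *)

(* Defs.v *)
From HB Require Import structures.
From mathcomp Require Import all_boot all_order all_algebra.
From mathcomp Require Import all_classical all_reals all_analysis.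

Set Implicit Arguments.
Unset Strict Implicit.
Unset Printing Implicit Defensive.

Import Order.TTheory GRing.Theory Num.Theory.
Import numFieldNormedType.Exports.

Local Open Scope classical_set_scope.
Local Open Scope ring_scope.

Definition frac_part (R : realType) (y : R) : R := y - (Num.floor y)%:~R.

Definition g_partial (R : realType) (x : R) (N : nat) : R :=
  \sum_(1 <= l < N.+1) (1 - 2 * frac_part (l%:R * x)) / l%:R.

(* [limn] is total: at the points of divergence, which form a null set, the
   value of [g] is an unspecified real number. *)
Definition g (R : realType) (x : R) : R := limn (g_partial x).

(* Euler's integral, which is finite for 0 < s. [Rintegral] returns 0 when the
   integral is infinite, so only positive arguments are meaningful. *)
Definition Gamma (R : realType) (s : R) : R :=
  Rintegral (@lebesgue_measure R) `]0, +oo[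
    (fun t : R => t `^ (s - 1) * expR (- t)).

(* Main.v *)
Require Import Defs.
From HB Require Import structures.
From mathcomp Require Import all_boot all_order all_algebra.
From mathcomp Require Import all_classical all_reals all_analysis.
From mathcomp Require Import measurable_realfun ring lra zify.
Set Implicit Arguments.
Unset Strict Implicit.
Unset Printing Implicit Defensive.
Import Order.TTheory GRing.Theory Num.Theory.
Import numFieldNormedType.Exports.
Local Open Scope classical_set_scope.
Local Open Scope ring_scope.

(** The moments have size Gamma(2k+1) because [g] looks like [ln (1/x)] near 0,
is odd about 1/2, and shows nothing of comparable size away from 0 and 1: the
2k-th moment of [ln (1/x)] on (0, 1) is exactly Gamma(2k+1).  Write G_N for the partial sums of [g], and T
for the Gauss map, the fractional part of 1/x.

The singularities of [g] at the other rationals are copies of the one at 0,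
scaled down by a reciprocity law.  Counting the lattice points below the line
of slope x by columns and by rows ([sum_floor_lattice]), and expanding the
harmonic sums and factorials which appear, gives
  G_N(x) + x G_M(T x) = ln (1/x) + L(x) + O(1/M),   M = floor(N x),
with L bounded ([g_partial_functional_equation]).  This is uniform in N, so it
can be used before anything is known about convergence, and since M < N it
allows inductions on N.

The heart of the upper bound is [lebesgue_tail]: the set where some |G_N|
exceeds y has measure O(exp(-y)).  By the oddness of G_N about 1/2 it is
enough to look at x < 1/2.  If floor(1/x) = n, then |G_N(x)| > y forces
|G_M(T x)| > n (y - C - ln(n+1)), and the n-th branch of the inverse of T
contracts lengths by 1/n^2.  As n >= 2, the induction hypothesis makes this
contribution about exp(-n y), far smaller than exp(-y), as long as n is below
a small multiple of exp(y); the remaining x fill an interval of length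
O(exp(-y)) at 0.  That interval is where the true size comes from.

Convergence almost everywhere uses the same mechanism.  The limit points of
the partial sums at x spread x times as widely as those at T x, so the set of
oscillation above y has at most twice the measure of the set of oscillation
above 2y ([oscillating_double]); iterating against the tail bound, the
doubling loses to the exponential ([lebesgue_oscillating]).

Finally both Gamma(2k+1) and the moment of [g] are compared with the series of
(j+1)^(2k) exp(-j).  For the integral of [g] the upper bound cuts (0, 1) along
the values of |g| and uses the tail ([integral_g_upper]).  The lower bound cuts
it along the scales exp(-j-1) < x < exp(-j), on most of which
g(x) >= j - C because T x avoids the tail set ([integral_g_lower]). *)

(** * Harmonic sums and Stirling's formula from two bounds on the logarithm *)

Lemma is_derive_ge0_le (R : realType) (f df : R -> R) (a b : R) : a <= b ->
  (forall x, a <= x -> is_derive x 1 f (df x)) ->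
  (forall x, a <= x -> 0 <= df x) -> f a <= f b.
Proof.
move=> ab fdf df0.
have itvP x : x \in `[a, b] -> a <= x by rewrite in_itv /= => /andP[].
have cf : {within `[a, b], continuous f}.
  apply: derivable_within_continuous => x /itvP ax.
  by have [] := fdf _ ax.
have fdf' x : x \in `]a, b[ -> is_derive x 1 f (df x).
  by rewrite in_itv /= => /andP[/ltW ax _]; exact: fdf.
have [c /itvP ac fbE] := MVT_segment ab fdf' cf.
by rewrite -subr_ge0 fbE mulr_ge0 ?subr_ge0 ?df0.
Qed.

(** Comparison of the integral of 1/x over [1, u] with the midpoint rule.  This
bound and the next are the only facts about the logarithm behind the expansions
of the harmonic sum, of the factorial and of the functional equation. *)
Lemma ln_ge_midpoint (R : realType) (u : R) : 1 <= u ->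
  2 * (u - 1) / (u + 1) <= ln u.
Proof.
move=> u1.
have d (x : R) : 1 <= x ->
  is_derive x 1 (fun x : R => ln x + 4 * (x + 1)^-1) (x^-1 + 4 * (- (x + 1) ^- 2)).
  move=> x1; have x0 : 0 < x by lra.
  have x10 : x + 1 != 0 by lra.
  have dl := is_derive1_ln x0.
  have di := @is_deriveV R (fun x : R => x + 1) x 1 1 x10.
  have di' : is_derive x (1 : R) (fun x : R => (x + 1)^-1) (- (x + 1) ^- 2).
    apply: (is_derive_eq (di _)); last by rewrite /GRing.scale /= mulr1.
    by apply: is_derive_eq; rewrite ?addr0.
  by apply: is_derive_eq.
have := is_derive_ge0_le u1 d; rewrite ln1 add0r => h.
have e2 : 4 * (1 + 1)^-1 = 2 :> R by field.
rewrite e2 in h; suff : 2 <= ln u + 4 * (u + 1)^-1.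
  move=> {}h; have -> : 2 * (u - 1) / (u + 1) = 2 - 4 * (u + 1)^-1 by field; lra.
  lra.
apply: h => x x1; have -> : x^-1 + 4 * (- (x + 1) ^- 2) = (x - 1) ^+ 2 / (x * (x + 1) ^+ 2).
  by field; apply/andP; split; lra.
by rewrite divr_ge0 ?sqr_ge0 // mulr_ge0 ?sqr_ge0 //; lra.
Qed.

(** Comparison of the integral of 1/x over [1, u] with the trapezoid rule. *)
Lemma ln_le_trapezoid (R : realType) (u : R) : 1 <= u ->
  ln u <= (u - u^-1) / 2.
Proof.
move=> u1.
have d (x : R) : 1 <= x ->
  is_derive x 1 (fun x : R => 2^-1 * (x - x^-1) - ln x) (2^-1 * (1 - (- x ^- 2)) - x^-1).
  move=> x1; have x0 : 0 < x by lra.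
  have x10 : x != 0 by lra.
  have dl := is_derive1_ln x0.
  have di := @is_deriveV R (fun x : R => x) x 1 1 x10.
  have di' : is_derive x (1 : R) (fun x : R => x^-1) (- x ^- 2).
    apply: (is_derive_eq (di _)); last by rewrite /GRing.scale /= mulr1.
  by apply: is_derive_eq.
have := is_derive_ge0_le u1 d; rewrite ln1 invr1 subrr mulr0 subr0 => h.
suff : 0 <= 2^-1 * (u - u^-1) - ln u by lra.
apply: h => x x1; have -> : 2^-1 * (1 - (- x ^- 2)) - x^-1 = 2^-1 * (1 - x^-1) ^+ 2.
  by field; lra.
by rewrite mulr_ge0 ?sqr_ge0 ?invr_ge0.
Qed.

(** Since [u + v] decreases while [u - v] increases, every [u m - v m] lies below
every [u n + v n], and the supremum of the former serves as limit.  Phrasing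
the increment bound as a difference gives the limit together with an explicit
rate, which is how each constant below is produced. *)
Lemma telescoping_limit (R : realType) (u v : nat -> R) :
  (forall n, (0 < n)%N -> `|u n.+1 - u n| <= v n - v n.+1) ->
  (forall n, (0 < n)%N -> 0 <= v n) ->
  exists l, forall n, (0 < n)%N -> `|u n - l| <= v n.
Proof.
move=> uv v0.
have lo n d : (0 < n)%N -> u n - v n <= u (n + d)%N - v (n + d)%N.
  move=> n0; elim: d => [|d IHd]; first by rewrite addn0.
  have := uv (n + d)%N; rewrite addn_gt0 n0 => /(_ isT).
  by rewrite addnS ler_norml => /andP[]; lra.
have hi n d : (0 < n)%N -> u (n + d)%N + v (n + d)%N <= u n + v n.
  move=> n0; elim: d => [|d IHd]; first by rewrite addn0.
  have := uv (n + d)%N; rewrite addn_gt0 n0 => /(_ isT).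
  by rewrite addnS ler_norml => /andP[]; lra.
have cross n m : (0 < n)%N -> (0 < m)%N -> u n - v n <= u m + v m.
  move=> n0 m0; have := lo n m n0; have := hi m n m0; rewrite addnC.
  by have := v0 (n + m)%N; rewrite addn_gt0 n0 => /(_ isT); lra.
pose E := [set u n - v n | n in [set n | (0 < n)%N]].
have supE : has_sup E.
  split; first by exists (u 1%N - v 1%N), 1%N.
  by exists (u 1%N + v 1%N) => _ [n n0 <-]; exact: cross.
exists (sup E) => n n0; rewrite ler_norml; apply/andP; split.
  suff : sup E <= u n + v n by lra.
  by apply: ge_sup; [exact: supE.1|move=> _ [m m0 <-]; exact: cross].
suff : u n - v n <= sup E by lra.
by apply: sup_upper_bound => //; exists n.
Qed.

Definition harmonic_sum (R : realType) (n : nat) : R := \sum_(1 <= k < n.+1) k%:R^-1.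

(** The increments of the left-hand side are errors of the trapezoid rule on
[n, n+1], squeezed between 0 and the difference of the midpoint and trapezoid
values. *)
Lemma harmonic_sum_asymptotic (R : realType) : exists gamma : R, forall n, (0 < n)%N ->
  `|harmonic_sum R n - ln n%:R - (2 * n%:R)^-1 - gamma| <= (4 * n%:R ^+ 2)^-1.
Proof.
apply: (@telescoping_limit R (fun n => harmonic_sum R n - ln n%:R - (2 * n%:R)^-1)
  (fun n => (4 * n%:R ^+ 2)^-1)) => n n0; last by rewrite invr_ge0 mulr_ge0 ?sqr_ge0.
rewrite /harmonic_sum [X in `|X - _ - _ - _|]big_nat_recr //=.
set H := \sum_(_ <= _ < _) _.
have x1 : 1 <= n%:R :> R by rewrite ler1n.
rewrite -natr1; set x := n%:R in x1 *.
have x0 : 0 < x by lra.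
have u1 : 1 <= (x + 1) / x by rewrite ler_pdivlMr //; lra.
have := ln_ge_midpoint u1; have := ln_le_trapezoid u1.
rewrite ln_div ?posrE //; last lra.
set a := ln _; set b := ln _ => h1 h2.
rewrite ler_norml; apply/andP; split.
  have : 0 <= (4 * x ^+ 2)^-1 - (4 * (x + 1) ^+ 2)^-1.
    rewrite subr_ge0 lef_pV2 ?posrE ?mulr_gt0 ?exprn_gt0 //; try lra.
  have : (x + 1)^-1 - (2 * (x + 1))^-1 + (2 * x)^-1 = ((x + 1) / x - ((x + 1) / x)^-1) / 2.
    by field; apply/andP; split; lra.
  lra.
have <- : (x + 1)^-1 - (2 * (x + 1))^-1 + (2 * x)^-1 - 2 * ((x + 1) / x - 1) / ((x + 1) / x + 1)
  + ((4 * x ^+ 2)^-1 - (4 * (x + 1) ^+ 2)^-1 - ((x + 1)^-1 - (2 * (x + 1))^-1 + (2 * x)^-1 - 2 * ((x + 1) / x - 1) / ((x + 1) / x + 1)))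
   = (4 * x ^+ 2)^-1 - (4 * (x + 1) ^+ 2)^-1 by ring.
suff : 0 <= (4 * x ^+ 2)^-1 - (4 * (x + 1) ^+ 2)^-1 - ((x + 1)^-1 - (2 * (x + 1))^-1 + (2 * x)^-1 - 2 * ((x + 1) / x - 1) / ((x + 1) / x + 1)).
  lra.
have -> : (4 * x ^+ 2)^-1 - (4 * (x + 1) ^+ 2)^-1 - ((x + 1)^-1 - (2 * (x + 1))^-1 + (2 * x)^-1 - 2 * ((x + 1) / x - 1) / ((x + 1) / x + 1))
  = (2 * x ^+ 2 + 2 * x + 1) / (4 * x ^+ 2 * (x + 1) ^+ 2 * (2 * x + 1)).
  by field; repeat (apply/andP; split); lra.
by rewrite divr_ge0 ?addr_ge0 ?mulr_ge0 ?sqr_ge0 //; lra.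
Qed.

(** Stirling's formula with an unspecified constant: only the existence of the
constant matters for boundedness of the functional equation. *)
Lemma ln_factorial_asymptotic (R : realType) : exists c : R, forall n, (0 < n)%N ->
  `|ln (n`!%:R : R) - ((n%:R + 2^-1) * ln n%:R - n%:R) - c| <= (4 * n%:R)^-1.
Proof.
apply: (@telescoping_limit R (fun n => ln (n`!%:R : R) - ((n%:R + 2^-1) * ln n%:R - n%:R))
  (fun n => (4 * n%:R)^-1)) => n n0; last by rewrite invr_ge0 mulr_ge0.
rewrite factS natrM lnM ?posrE ?ltr0n ?fact_gt0 //.
have x1 : 1 <= n%:R :> R by rewrite ler1n.
rewrite -natr1; set x := n%:R in x1 *.
have x0 : 0 < x by lra.
have u1 : 1 <= (x + 1) / x by rewrite ler_pdivlMr //; lra.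
have := ln_ge_midpoint u1; have := ln_le_trapezoid u1.
rewrite ln_div ?posrE //; last lra.
set a := ln _; set b := ln _; set c := ln _ => h1 h2.
have -> : a + c - ((x + 1 + 2^-1) * a - (x + 1)) - (c - ((x + 2^-1) * b - x)) =
  1 - (x + 2^-1) * (a - b) by ring.
have h1' : (x + 2^-1) * (a - b) <= (x + 2^-1) * (((x + 1) / x - ((x + 1) / x)^-1) / 2).
  by rewrite ler_pM2l //; lra.
have h2' : (x + 2^-1) * (2 * ((x + 1) / x - 1) / ((x + 1) / x + 1)) <= (x + 2^-1) * (a - b).
  by rewrite ler_pM2l //; lra.
have e1 : (x + 2^-1) * (((x + 1) / x - ((x + 1) / x)^-1) / 2) = 1 + ((4 * x)^-1 - (4 * (x + 1))^-1).
  by field; repeat (apply/andP; split); lra.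
have e2 : (x + 2^-1) * (2 * ((x + 1) / x - 1) / ((x + 1) / x + 1)) = 1.
  by field; repeat (apply/andP; split); lra.
rewrite ler_norml; apply/andP; split; lra.
Qed.

(** * Irrationals, the Gauss map and a lattice point identity *)

Lemma frac_part_nat (R : realType) (n : nat) (y : R) :
  n%:R <= y < n.+1%:R -> frac_part y = y - n%:R.
Proof.
by move=> h; rewrite /frac_part (@floor_def R y n%:Z) // intrD natr1.
Qed.

Lemma frac_partE (R : realType) (y : R) :
  0 <= y -> frac_part y = y - (Num.trunc y)%:R.
Proof. by move=> /truncn_itv /frac_part_nat. Qed.

Lemma frac_part_bounds (R : realType) (y : R) : 0 <= frac_part y < 1.
Proof.
have := floor_le y; have := floorD1_gt y; rewrite /frac_part intrD.
by move=> h1 h2; apply/andP; split; lra.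
Qed.

Lemma frac_partBn (R : realType) (y : R) (n : nat) : frac_part (y - n%:R) = frac_part y.
Proof.
rewrite /frac_part floorDrz ?rpredN ?natr_int //.
have -> : - (n%:R : R) = (- n%:Z)%:~R by rewrite intrN.
by rewrite intrKfloor intrD intrN; ring.
Qed.

(** The irrationals of (0, 1).  Restricting to them costs a null set and removes
the ties in floors: [l * x] never hits an integer. *)
Definition irrational01 (R : realType) : set R :=
  [set x | 0 < x < 1 /\ forall l m : nat, (0 < l)%N -> l%:R * x != m%:R].

Definition gauss_map (R : realType) (x : R) : R := frac_part x^-1.

Lemma irrational01_gauss (R : realType) (x : R) :
  irrational01 x -> irrational01 (gauss_map x).
Proof.
move=> [/andP[x0 x1] xirr].
have xV0 : 0 <= x^-1 by rewrite invr_ge0 ltW.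
rewrite /gauss_map frac_partE //; set n := Num.trunc _.
have key l m : (0 < l)%N -> l%:R * (x^-1 - n%:R) != m%:R.
  move=> l0; apply/eqP => h.
  have mn0 : (0 < m + l * n)%N.
    by rewrite addn_gt0 muln_gt0 l0 /= /n truncn_gt0 invf_ge1 ?(ltW x1) ?orbT.
  have /eqP := xirr (m + l * n)%N l mn0; apply.
  rewrite natrD natrM -h; field; lra.
split => //; have := frac_part_bounds x^-1; rewrite frac_partE // -/n => /andP[h ->].
rewrite andbT lt_neqAle h andbT.
by have := key 1%N 0%N isT; rewrite mul1r eq_sym.
Qed.

Lemma irrational01_1B (R : realType) (x : R) :
  irrational01 x -> irrational01 (1 - x).
Proof.
move=> [/andP[x0 x1] xirr]; split; first by apply/andP; split; lra.
move=> l m l0; apply/eqP => h.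
have lm : l%:R * x = l%:R - m%:R by rewrite -h; ring.
have ml : (m <= l)%N.
  rewrite -(ler_nat R) -subr_ge0 -lm mulr_ge0 //; lra.
by have /eqP := xirr l (l - m)%N l0; apply; rewrite natrB.
Qed.

Lemma truncn_irrational (R : realType) (x : R) (l : nat) : irrational01 x -> (0 < l)%N ->
  (Num.trunc (l%:R * x))%:R < l%:R * x < (Num.trunc (l%:R * x)).+1%:R.
Proof.
move=> [/andP[x0 x1] xirr] l0.
have /truncn_itv/andP[h ->] : 0 <= l%:R * x by rewrite mulr_ge0 // ltW.
by rewrite andbT lt_neqAle h andbT eq_sym xirr.
Qed.

(** Both sides weigh by 1/l the lattice points (l, m) with 1 <= l <= N and
1 <= m <= l x, the left one column by column and the right one row by row: in
row m the admissible l are those above m/x.  Irrationality of x makes the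
count of l excluded exactly floor(m/x). *)
Lemma sum_floor_lattice (R : realType) (x : R) (N : nat) : irrational01 x ->
  \sum_(1 <= l < N.+1) (Num.trunc (l%:R * x))%:R / l%:R =
  (Num.trunc (N%:R * x))%:R * harmonic_sum R N -
  \sum_(1 <= m < (Num.trunc (N%:R * x)).+1) harmonic_sum R (Num.trunc (m%:R / x)).
Proof.
move=> xI; have [/andP[x0 x1] xirr] := xI.
elim: N => [|N IHN].
  by rewrite mul0r truncn0 !big_nil mul0r subr0 // big_geq.
rewrite big_nat_recr //= IHN.
set M := Num.trunc (N%:R * x) in IHN *.
set M' := Num.trunc (N.+1%:R * x).
have HS : harmonic_sum R N.+1 = harmonic_sum R N + N.+1%:R^-1.
  by rewrite /harmonic_sum big_nat_recr.
have Nx0 : 0 <= N%:R * x by rewrite mulr_ge0 // ltW.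
have /andP[hM hM1] : M%:R <= N%:R * x < M.+1%:R by exact: truncn_itv.
have /andP[hM' hM'1] := truncn_irrational (l := N.+1) xI isT.
rewrite -/M' in hM' hM'1.
have MM' : (M <= M')%N by rewrite /M /M' le_truncn // ler_wpM2r ?ler_nat // ltW.
have M'M : (M' <= M.+1)%N.
  rewrite -ltnS -(ltr_nat R); apply: (lt_trans hM').
  rewrite -natr1 mulrDl mul1r -[in ltRHS]natr1; lra.
have [e|ne] := eqVneq M' M.
  rewrite e HS; set A := \sum_(_ <= _ < _) _; ring.
have {ne MM' M'M} e : M' = M.+1.
  by apply/eqP; rewrite eqn_leq M'M /= ltn_neqAle MM' andbT eq_sym.
rewrite e [in RHS]big_nat_recr //=.
have -> : Num.trunc (M.+1%:R / x) = N.
  apply: truncn_def; rewrite ler_pdivlMr // ltr_pdivrMr // (ltW hM1) /=.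
  by rewrite -e.
rewrite HS -[in RHS]natr1 -[M.+1%:R in LHS]natr1; set A := \sum_(_ <= _ < _) _.
set n := N.+1%:R^-1; ring.
Qed.

Lemma g_partial_harmonic (R : realType) (x : R) (N : nat) : 0 <= x ->
  g_partial x N = harmonic_sum R N - 2 * (N%:R * x) +
    2 * \sum_(1 <= l < N.+1) (Num.trunc (l%:R * x))%:R / l%:R.
Proof.
move=> x0; rewrite /g_partial /harmonic_sum; elim: N => [|N IHN].
  by rewrite !big_geq // mul0r; ring.
rewrite !(@big_nat_recr _ _ _ N.+1) //= IHN frac_partE ?mulr_ge0 //.
have n0 : N.+1%:R != 0 :> R by rewrite pnatr_eq0.
move: n0; rewrite -natr1.
set A := \sum_(_ <= _ < _) _; set B := \sum_(_ <= _ < _) _.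
by move=> n0; field.
Qed.

(** At a real point y the harmonic sum jumps, and to second order its deviation
from [ln y + gamma] is the sawtooth (1 - 2{y}) / (2y).  Summed over y = m/x this
sawtooth reproduces a partial sum of [g] at the Gauss image of x, which is why
the recursion closes up. *)
Lemma harmonic_floor_asymptotic (R : realType) (gamma : R) :
  (forall n, (0 < n)%N ->
    `|harmonic_sum R n - ln n%:R - (2 * n%:R)^-1 - gamma| <= (4 * n%:R ^+ 2)^-1) ->
  forall y : R, 1 <= y ->
  `|harmonic_sum R (Num.trunc y) - ln y - gamma - (1 - 2 * frac_part y) / (2 * y)|
    <= 5 / y ^+ 2.
Proof.
move=> Hg y y1; have y0 : 0 <= y by lra.
have n0 : (0 < Num.trunc y)%N by rewrite truncn_gt0.
rewrite frac_partE //; have /andP[] := truncn_itv y0; have := Hg _ n0.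
set H := harmonic_sum R _; rewrite -[(Num.trunc y).+1%:R]natr1.
have : 1 <= (Num.trunc y)%:R :> R by rewrite ler1n.
set n := (Num.trunc y)%:R => n1 Hn ny yn.
have u1 : 1 <= y / n by rewrite ler_pdivlMr //; lra.
have := ln_ge_midpoint u1; have := ln_le_trapezoid u1.
rewrite ln_div ?posrE //; try lra.
set a := ln y; set b := ln n in Hn * => h1 h2.
set f := y - n; have yE : y = n + f by rewrite /f; ring.
have f0 : 0 <= f by rewrite /f; lra.
have f1 : f < 1 by rewrite /f; lra.
have k1 : f / (n * y) <= (n ^+ 2)^-1.
  rewrite ler_pdivrMr ?mulr_gt0 //; try lra.
  have -> : (n ^+ 2)^-1 * (n * y) = y / n by field; lra.
  by rewrite ler_pdivlMr; nra.
have k1' : f ^+ 2 / (n * y) <= f / (n * y).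
  have ff : f ^+ 2 <= f by nra.
  by rewrite ler_pM2r ?invr_gt0 ?mulr_gt0 //; lra.
have k0 : 0 <= f / (n * y) by rewrite divr_ge0 ?mulr_ge0 //; lra.
have e1 : (y / n - (y / n)^-1) / 2 = f / y + (f ^+ 2 / (n * y)) / 2.
  rewrite /f; field; apply/andP; split; lra.
have e2 : 2 * (y / n - 1) / (y / n + 1) - f / y = f ^+ 2 / (y * (y + n)).
  rewrite /f; field; repeat (apply/andP; split); lra.
have k2 : 0 <= f ^+ 2 / (y * (y + n)).
  by rewrite divr_ge0 ?sqr_ge0 ?mulr_ge0 //; lra.
have e3 : (2 * n)^-1 - (2 * y)^-1 = f / (n * y) / 2.
  rewrite /f; field; apply/andP; split; lra.
have e4 : (1 - 2 * f) / (2 * y) = (2 * y)^-1 - f / y by field; lra.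
have e5 : (4 * n ^+ 2)^-1 = (n ^+ 2)^-1 / 4 by field; lra.
have k3 : 5 / 4 * (n ^+ 2)^-1 <= 5 / y ^+ 2.
  have -> : 5 / y ^+ 2 = 5 / 4 * (y ^+ 2 / 4)^-1 by field; lra.
  have y2n : 0 <= (2 * n - y) * (2 * n + y) by apply: mulr_ge0; lra.
  have yn2 : y ^+ 2 / 4 <= n ^+ 2 by nra.
  by rewrite ler_pM2l ?lef_pV2 ?posrE ?divr_gt0 ?exprn_gt0 //; lra.
move: Hn; rewrite e4 e5 !ler_norml => /andP[Hn1 Hn2].
by apply/andP; split; lra.
Qed.

(** * The approximate functional equation *)

(** The rows of the lattice sum, expanded with [harmonic_floor_asymptotic].  The
partial sum at [gauss_map x] appears because m/x and m * gauss_map x differ by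
an integer.  The last sum is the accumulated error, which converges as its
terms are O(1/m^2). *)
Lemma sum_inv_frac_asymptotic_remainder (R : realType) (gamma x : R) (M : nat) : 0 < x ->
  \sum_(1 <= m < M.+1) harmonic_sum R (Num.trunc (m%:R / x)) =
  ln M`!%:R - M%:R * ln x + gamma * M%:R + x / 2 * g_partial (gauss_map x) M +
  \sum_(1 <= m < M.+1) (harmonic_sum R (Num.trunc (m%:R / x)) - ln (m%:R / x) - gamma
     - (1 - 2 * frac_part (m%:R / x)) / (2 * (m%:R / x))).
Proof.
move=> x0; elim: M => [|M IHM].
  by rewrite /g_partial !big_geq // fact0 ln1; ring.
rewrite /g_partial !(@big_nat_recr _ _ _ M.+1) //= IHM factS natrM /g_partial.
rewrite lnM ?posrE ?ltr0n ?fact_gt0 // ln_div ?posrE ?ltr0n //.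
have -> : frac_part (M.+1%:R * gauss_map x) = frac_part (M.+1%:R / x).
  rewrite /gauss_map (@frac_partE _ x^-1) ?invr_ge0 ?(ltW x0) // mulrBr -natrM.
  by rewrite frac_partBn.
have n0 : M.+1%:R != 0 :> R by rewrite pnatr_eq0.
rewrite -[in M.+1%:R * ln x]natr1 -[in gamma * M.+1%:R]natr1; move: n0.
set n := M.+1%:R; set h := harmonic_sum _ _; set A := \sum_(_ <= _ < _) _.
set B := \sum_(_ <= _ < _) _.
by move=> n0; field; lra.
Qed.

(** The term [L] may depend on x but not on N: it collects Euler's constant,
Stirling's constant and the limit of the accumulated errors.  The rate 1/M is
what makes the oscillations at x and at [gauss_map x] comparable. *)
Lemma g_partial_functional_equation (R : realType) : exists2 C : R, 0 <= C &
  forall x : R, irrational01 x -> exists2 L : R, `|L| <= C &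
  forall N M : nat, M = Num.trunc (N%:R * x) -> (0 < M)%N ->
  `|g_partial x N + x * g_partial (gauss_map x) M + ln x - L| <= C / M%:R.
Proof.
have [gamma Hg] := harmonic_sum_asymptotic R.
have [c Hc] := ln_factorial_asymptotic R.
(* 34 covers both the bound 21 on the x and e parts of L and the total 13 / M of the error terms. *)
exists (`|gamma| + 2 * `|c| + 34) => [|x xI]; first by rewrite !addr_ge0 ?mulr_ge0.
have [/andP[x0 x1] _] := xI.
pose eps m := harmonic_sum R (Num.trunc (m%:R / x)) - ln (m%:R / x) - gamma
     - (1 - 2 * frac_part (m%:R / x)) / (2 * (m%:R / x)).
have epsE m : (0 < m)%N -> `|eps m| <= 5 / m%:R ^+ 2.
  move=> m0; have m1 : 1 <= m%:R :> R by rewrite ler1n.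
  have mx1 : m%:R <= m%:R / x.
    by rewrite ler_pdivlMr // ler_piMr // ltW.
  have := harmonic_floor_asymptotic Hg (le_trans m1 mx1) => /le_trans; apply.
  rewrite ler_pM2l // lef_pV2 ?posrE ?exprn_gt0 //; try lra.
  by rewrite lerXn2r ?nnegrE //; lra.
have [e He] : exists e, forall M, (0 < M)%N ->
    `|\sum_(1 <= m < M.+1) eps m - e| <= 5 / M%:R.
  apply: telescoping_limit => n n0; last by rewrite divr_ge0.
  rewrite [X in `|X - _|]big_nat_recr //= addrAC subrr add0r.
  apply: (le_trans (epsE _ _)) => //.
  have : 1 <= n%:R :> R by rewrite ler1n.
  rewrite -[n.+1%:R]natr1; set k := n%:R => k1.
  have -> : 5 / k - 5 / (k + 1) = 5 / (k * (k + 1)) by field; apply/andP; split; lra.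
  by rewrite ler_pM2l // lef_pV2 ?posrE ?mulr_gt0 ?exprn_gt0 //; try lra; nra.
have e10 : `|e| <= 10.
  have := He 1%N isT; rewrite big_nat1 divr1; have := epsE 1%N isT.
  by rewrite expr1n divr1 !ler_norml => /andP[a1 a2] /andP[b1 b2]; apply/andP; split; lra.
exists (gamma - 2 * c + x - 2 * e).
  have := ler_normD (gamma - 2 * c + x) (- (2 * e)).
  have := ler_normD (gamma - 2 * c) x; have := ler_normD gamma (- (2 * c)).
  by rewrite !normrN !normrM (ger0_norm (ltW x0)) (ger0_norm (x := 2)) //; lra.
move=> N M ME M0.
have N0 : (0 < N)%N.
  by case: N ME => [|//]; rewrite mul0r truncn0 => M0'; rewrite M0' in M0.
rewrite g_partial_harmonic ?(ltW x0) // sum_floor_lattice // -ME.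
rewrite (sum_inv_frac_asymptotic_remainder gamma) // -/eps.
have /andP[] : M%:R <= N%:R * x < M.+1%:R by rewrite ME truncn_itv // mulr_ge0 // ltW.
have := He M M0; have := Hc M M0; have := Hg N N0.
have n1 : 1 <= N%:R :> R by rewrite ler1n.
have m1 : 1 <= M%:R :> R by rewrite ler1n.
have := @ln_ge_midpoint R (N%:R * x / M%:R); have := @le_ln1Dx R (N%:R * x / M%:R - 1).
rewrite [1 + (_ - 1)]addrC subrK ln_div ?lnM ?posrE ?mulr_gt0 ?ltr0n //.
rewrite -[M.+1%:R]natr1; move: n1 m1.
set E := \sum_(_ <= _ < _) _; set h := harmonic_sum _ _; set G := g_partial _ _.
set n := N%:R; set m := M%:R; set lf := ln _`!%:R; set lx := ln x; set lm := ln m; set lN := ln n.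
rewrite /lm /lN -/m -/n -/lm -/lN.
clearbody E h G lf lx lm lN n m; clear -x0 x1 => n1 m1 U1 U2 Hn Hf HE nx1 nx2.
set f := n * x - m; have f0 : 0 <= f by rewrite /f; lra.
have f1 : f < 1 by rewrite /f; lra.
have nxE : n * x = m + f by rewrite /f; ring.
have nm : m <= n.
  have : n * x <= n by rewrite ler_piMr //; lra.
  lra.
have m0 : 0 < m by lra.
have n0 : 0 < n by lra.
have {}U1 : lN + lx - lm <= f / m.
  have -> : f / m = n * x / m - 1.
    by rewrite /f; field; lra.
  apply: U1; rewrite nxE mulrDl divff; last lra.
  have : 0 <= f / m by rewrite divr_ge0 // ltW.
  lra.
have {}U2 : 2 * f / (2 * m + f) <= lN + lx - lm.
  have -> : 2 * f / (2 * m + f) = 2 * (n * x / m - 1) / (n * x / m + 1).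
    by rewrite /f; field; apply/andP; split; rewrite ?nxE; lra.
  by apply: U2; rewrite ler_pdivlMr //; lra.
clearbody f.
set V := m^-1; have V0 : 0 < V by rewrite invr_gt0.
have V1 : V * m = 1 by rewrite mulVf //; lra.
have W1 : `|(2 * m + 1) * (lN + lx - lm) - 2 * f| <= V.
  rewrite ger0_norm.
    have : (2 * m + 1) * (lN + lx - lm) <= (2 * m + 1) * (f / m) by rewrite ler_pM2l //; lra.
    have -> : (2 * m + 1) * (f / m) = 2 * f + f * V by rewrite /V; field; lra.
    have : f * V <= V by rewrite ler_piMl // ltW.
    lra.
  have : (2 * m + 1) * (2 * f / (2 * m + f)) <= (2 * m + 1) * (lN + lx - lm).
    by rewrite ler_pM2l //; lra.
  have -> : (2 * m + 1) * (2 * f / (2 * m + f)) = 2 * f + 2 * (f * (1 - f)) / (2 * m + f).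
    by field; lra.
  have : 0 <= 2 * (f * (1 - f)) / (2 * m + f).
    by rewrite divr_ge0 ?mulr_ge0 //; lra.
  lra.
have nV : n^-1 <= V by rewrite lef_pV2.
have nV0 : 0 < n^-1 by rewrite invr_gt0.
have W2 : `|(2 * m + 1) / (2 * n) - x| <= V / 2.
  have -> : (2 * m + 1) / (2 * n) - x = (1 - 2 * f) * n^-1 / 2.
    have -> : x = (m + f) / n by rewrite -nxE; field; lra.
    by field; lra.
  rewrite normrM (ger0_norm (x := 2^-1)) // ler_pM2r //.
  rewrite normrM (ger0_norm (x := n^-1)) ?(ltW nV0) //.
  apply: le_trans nV; rewrite ler_piMl ?(ltW nV0) // ler_norml.
  by apply/andP; split; lra.
set r1 := h - lN - (2 * n)^-1 - gamma in Hn.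
set r2 := lf - ((m + 2^-1) * lm - m) - c in Hf.
set r3 := E - e in HE.
have W3 : `|(2 * m + 1) * r1| <= V.
  rewrite normrM ger0_norm; last lra.
  apply: (@le_trans _ _ ((2 * m + 1) * (4 * n ^+ 2)^-1)); first by rewrite ler_pM2l //; lra.
  apply: (@le_trans _ _ ((2 * m + 1) * (4 * m ^+ 2)^-1)).
    rewrite ler_pM2l; last lra.
    rewrite lef_pV2 ?posrE ?mulr_gt0 ?exprn_gt0 // ler_pM2l // lerXn2r ?nnegrE //; lra.
  rewrite ler_pdivrMr ?mulr_gt0 ?exprn_gt0 //.
  have -> : V * (4 * m ^+ 2) = 4 * m * (V * m) by ring.
  by rewrite V1; lra.
have W4 : `|r2| <= V / 4.
  by have -> : V / 4 = (4 * m)^-1 by rewrite /V; field; lra.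
have W5 : `|r3| <= 5 * V by [].
set Q := (X in `|X|).
(* The main terms, grouped so that each one is O(1/m). *)
have -> : Q = ((2 * m + 1) * (lN + lx - lm) - 2 * f) + ((2 * m + 1) / (2 * n) - x)
   + (2 * m + 1) * r1 - 2 * r2 - 2 * r3.
  rewrite /Q /r1 /r2 /r3 nxE.
  by field; lra.
apply: (@le_trans _ _ (34 * V)); last first.
  by rewrite ler_pM2r // lerDr addr_ge0 ?mulr_ge0.
move: W1 W2 W3 W4 W5.
set w1 := (2 * m + 1) * (lN + lx - lm) - 2 * f; set w2 := (2 * m + 1) / (2 * n) - x.
set w3 := (2 * m + 1) * r1.
rewrite !ler_norml => /andP[? ?] /andP[? ?] /andP[? ?] /andP[? ?] /andP[? ?].
by apply/andP; split; lra.
Qed.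

Lemma harmonic_sum_le (R : realType) (n : nat) : (0 < n)%N ->
  harmonic_sum R n <= 1 + ln n%:R.
Proof.
elim: n => [//|[_ _|n IHn _]]; first by rewrite /harmonic_sum big_nat1 invr1 ln1 addr0.
rewrite /harmonic_sum big_nat_recr //= -/(harmonic_sum R n.+1).
apply: (le_trans (lerD (IHn isT) (lexx _))).
rewrite -[n.+2%:R]natr1.
have : 1 <= n.+1%:R :> R by rewrite ler1n.
set m := n.+1%:R => m1.
have u1 : 1 <= (m + 1) / m by rewrite ler_pdivlMr //; lra.
have := ln_ge_midpoint u1; rewrite ln_div ?posrE //; try lra.
have -> : 2 * ((m + 1) / m - 1) / ((m + 1) / m + 1) = (m + 2^-1)^-1.
  by field; repeat (apply/andP; split); lra.
have : (m + 1)^-1 <= (m + 2^-1)^-1 by rewrite lef_pV2 ?posrE; lra.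
lra.
Qed.

(** When N x < 1 no lattice point is present, and the partial sum is a harmonic
sum of length below 1/x minus the bounded quantity 2 N x. *)
Lemma g_partial_small (R : realType) (x : R) (N : nat) : irrational01 x ->
  Num.trunc (N%:R * x) = 0%N -> `|g_partial x N| <= 3 - ln x.
Proof.
move=> xI M0; have [/andP[x0 x1] _] := xI.
have lx : ln x <= 0 by rewrite ln_le0 // ltW.
case: N M0 => [_|N M0]; first by rewrite /g_partial big_geq // normr0; lra.
rewrite g_partial_harmonic ?(ltW x0) // sum_floor_lattice // M0 mul0r big_geq // subr0 mulr0 addr0.
have Nx0 : 0 <= N.+1%:R * x by rewrite mulr_ge0 // ltW.
have := truncn_itv Nx0; rewrite M0 => /andP[_ Nx1].
have H0 : 0 <= harmonic_sum R N.+1 by apply: sumr_ge0 => i _; rewrite invr_ge0.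
have := @harmonic_sum_le R N.+1 isT.
have : ln (N.+1%:R * x) <= 0 by rewrite ln_le0 // ltW.
rewrite lnM ?posrE ?ltr0n // => h1 h2.
by rewrite ler_norml; apply/andP; split; lra.
Qed.

Lemma g_partial_odd (R : realType) (x : R) (N : nat) : irrational01 x ->
  g_partial (1 - x) N = - g_partial x N.
Proof.
move=> xI; rewrite /g_partial -sumrN !big_nat; apply: eq_bigr => l /andP[l0 _].
have /andP[h1 h2] := truncn_irrational xI l0.
have [/andP[x0 x1] _] := xI.
have lx0 : 0 <= l%:R * x by rewrite mulr_ge0 // ltW.
rewrite (frac_partE lx0); set n := Num.trunc _ in h1 h2 *.
have nl : (n < l)%N.
  by rewrite -(ltr_nat R); apply: (lt_trans h1); rewrite gtr_pMr // ltr0n.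
have -> : l%:R * (1 - x) = (l - n.+1)%:R - (l%:R * x - n.+1%:R) by rewrite natrB //; ring.
rewrite (@frac_part_nat _ (l - n.+1)); last first.
  rewrite -[(l - n.+1).+1%:R]natr1 -[n.+1%:R]natr1; apply/andP; split; last lra.
  by move: h2; rewrite -[n.+1%:R]natr1; lra.
rewrite -[n.+1%:R]natr1; field; rewrite pnatr_eq0; lia.
Qed.

(** * Lebesgue measure along the branches of the Gauss map *)

(** [lebesgue_measure] is by construction an outer measure on all subsets, so
monotonicity and subadditivity need no measurability.  This keeps the images of
sets under the branches of the Gauss map free of measurability side goals. *)
Lemma lebesgue_le (R : realType) (A B : set R) : A `<=` B ->
  (lebesgue_measure A <= lebesgue_measure B)%E.
Proof. exact: (@le_outer_measure _ _ ((@wlength R idfun)^*)%mu). Qed.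

Lemma lebesgue_subU (R : realType) (A B : set R) :
  (lebesgue_measure (A `|` B) <= lebesgue_measure A + lebesgue_measure B)%E.
Proof. exact: (@outer_measureU2 _ _ ((@wlength R idfun)^*)%mu). Qed.

Lemma lebesgue_sub_bigcup (R : realType) (F : (set R)^nat) :
  (lebesgue_measure (\bigcup_n F n) <= \sum_(n <oo) lebesgue_measure (F n))%E.
Proof. exact: (@outer_measure_sigma_subadditive _ _ ((@wlength R idfun)^*)%mu). Qed.

Lemma lebesgue_sub_bigsetU (R : realType) (F : (set R)^nat) n :
  (lebesgue_measure (\big[setU/set0]_(i < n) F i) <= \sum_(i < n) lebesgue_measure (F i))%E.
Proof. exact: (@outer_measure_subadditive _ _ ((@wlength R idfun)^*)%mu). Qed.

Lemma lebesgue_diameter (R : realType) (S : set R) (D : R) : 0 <= D ->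
  (forall p q, S p -> S q -> `|p - q| <= D) -> (lebesgue_measure S <= D%:E)%E.
Proof.
move=> D0 SD; have [->|/set0P[p0 Sp0]] := eqVneq S set0; first by rewrite measure0 lee_fin.
have muD : lebesgue_measure `[inf S, inf S + D]%classic = D%:E.
  rewrite lebesgue_measure_itv /= lte_fin ltrDl.
  case: ltP => [_|D0']; first by rewrite -EFinB; congr EFin; ring.
  by congr EFin; lra.
rewrite -muD; apply: lebesgue_le => p Sp /=.
have infS : has_inf S.
  by split; [exists p0|exists (p0 - D) => q /(SD _ _ Sp0); rewrite ler_norml => /andP[]; lra].
rewrite in_itv /=; apply/andP; split; first by apply: inf_lbound => //; exact: infS.2.
have : p - D <= inf S.
  apply: lb_le_inf; first exact: infS.1.
  by move=> q /(SD _ _ Sp); rewrite ler_norml => /andP[]; lra.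
lra.
Qed.

(** Push a cover of [A] by intervals forward: the part of [A] in an interval of
length r has an image of diameter at most K r. *)
Lemma lebesgue_lipschitz (R : realType) (phi : R -> R) (K : R) (A B : set R) : 0 < K ->
  (forall x y, A x -> A y -> `|phi x - phi y| <= K * `|x - y|) -> B `<=` phi @` A ->
  (lebesgue_measure B <= K%:E * lebesgue_measure A)%E.
Proof.
move=> K0 phiK BA; apply: (le_trans (lebesgue_le BA)).
rewrite -lee_pdivrMl //.
apply: le_ereal_inf_tmp => _ /= [F [mF AF] <-].
rewrite lee_pdivrMl //.
apply: (@le_trans _ _ (\sum_(n <oo) lebesgue_measure (phi @` (A `&` F n)))%E).
  apply: (le_trans _ (lebesgue_sub_bigcup _)); apply: lebesgue_le.
  by move=> _ [x Ax <-]; have [n _ Fnx] := AF x Ax; exists n => //; exists x.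
rewrite -nneseriesZl //.
apply: lee_nneseries => // n _.
have /ocitvP[->|[[a b] /= ab ->]] : ocitv (F n) by exact: mF.
  by rewrite setI0 image_set0 measure0 mule_ge0 ?wlength_ge0 // lee_fin ltW.
rewrite (wlength_itv_bnd _ _ _ (ltW ab)) /= -EFinM.
apply: lebesgue_diameter; first by rewrite mulr_ge0 ?subr_ge0 // ltW.
move=> _ _ [x [Ax xab] <-] [y [Ay yab] <-].
apply: (le_trans (phiK _ _ Ax Ay)); rewrite ler_pM2l //.
move: xab yab; rewrite /= !in_itv /= => /andP[? ?] /andP[? ?].
by rewrite ler_norml; apply/andP; split; lra.
Qed.

(** On the points with floor(1/x) = n the Gauss map is inverted by
u |-> 1/(n + u), which is Lipschitz with constant 1/n^2 on (0, 1).  The finite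
range of n together with the cut-off [delta] at 0 avoids infinite series. *)
Lemma lebesgue_gauss_branches (R : realType) (Q : set R) (delta : R) (A : nat -> set R)
    (a : nat -> R) (m0 m1 : nat) : 0 <= delta -> (0 < m0)%N ->
  Q `<=` @irrational01 R ->
  (forall n, A n `<=` @irrational01 R) ->
  (forall n, (m0 <= n < m1)%N -> (lebesgue_measure (A n) <= (a n)%:E)%E) ->
  (forall x, Q x -> x <= delta \/ (m0 <= Num.trunc x^-1 < m1)%N /\ A (Num.trunc x^-1) (gauss_map x)) ->
  (lebesgue_measure Q <= (delta + \sum_(m0 <= n < m1) a n / n%:R ^+ 2)%:E)%E.
Proof.
move=> d0 m00 Qirr Airr Aa QA.
pose F n := if (m0 <= n)%N then [set (n%:R + u)^-1 | u in A n] else set0.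
have QF : Q `<=` `[0, delta]%classic `|` \big[setU/set0]_(n < m1) F n.
  move=> x Qx; have [/andP[x0 x1] _] := Qirr x Qx.
  have [xd|[/andP[mn nm] Ax]] := QA x Qx.
    by left; rewrite /= in_itv /= (ltW x0).
  right; rewrite -bigcup_mkord; exists (Num.trunc x^-1) => //.
  rewrite /F mn; exists (gauss_map x) => //.
  by rewrite /gauss_map frac_partE ?invr_ge0 ?(ltW x0) // addrC subrK invrK.
apply: (le_trans (lebesgue_le QF)); apply: (le_trans (lebesgue_subU _ _)).
rewrite EFinD; apply: leeD.
  rewrite lebesgue_measure_itv /= lte_fin.
  by case: ifP => _; rewrite ?oppr0 ?adde0 lee_fin.
apply: (le_trans (lebesgue_sub_bigsetU _ _)).
rewrite big_geq_mkord /= [in leRHS]big_mkcond /= -sumEFin.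
apply: lee_sum => -[n nm1] _ /=; rewrite /F; case: ifP => [mn|_]; last by rewrite measure0.
have n0 : 0 < n%:R :> R by rewrite ltr0n (leq_trans m00).
rewrite mulrC EFinM.
apply: (le_trans _ (lee_wpmul2l _ (Aa n _))); last by rewrite mn.
  apply: lebesgue_lipschitz (@subset_refl _ _).
    by rewrite invr_gt0 exprn_gt0.
  move=> u v /Airr[/andP[u0 _] _] /Airr[/andP[v0 _] _].
  have -> : (n%:R + u)^-1 - (n%:R + v)^-1 = ((n%:R + u) * (n%:R + v))^-1 * (v - u).
    by field; apply/andP; split; lra.
  rewrite normrM distrC ger0_norm ?invr_ge0 ?mulr_ge0 //; try lra.
  rewrite ler_wpM2r // lef_pV2 ?posrE ?mulr_gt0 ?exprn_gt0 //; try lra.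
  by rewrite expr2 ler_pM //; lra.
by rewrite lee_fin invr_ge0 exprn_ge0 // ltW.
Qed.

Lemma lebesgue_symmetric (R : realType) (Q : set R) : Q `<=` @irrational01 R ->
  (forall x, Q x -> Q (1 - x)) ->
  (lebesgue_measure Q <= 2%:E * lebesgue_measure (Q `&` [set x | (x < 2^-1)%R]))%E.
Proof.
move=> Qirr Qsym; set Q' := _ `&` _.
have QU : Q `<=` Q' `|` [set 1 - x | x in Q'].
  move=> x Qx; case: (ltgtP x 2^-1) => [xh|xh|xh]; first by left.
    right; exists (1 - x); last by ring.
    by split; [exact: Qsym|rewrite /=; lra].
  have [_ /(_ 2%N 1%N isT)] := Qirr x Qx.
  by rewrite xh mulfV ?pnatr_eq0 // eqxx.
apply: (le_trans (lebesgue_le QU)); apply: (le_trans (lebesgue_subU _ _)).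
rewrite (_ : 2%:E = 1%:E + 1%:E)%E; last by rewrite -EFinD.
rewrite ge0_muleDl // mul1e leeD // -[leRHS]mul1e.
apply: lebesgue_lipschitz (@subset_refl _ _) => // x y _ _.
have -> : 1 - x - (1 - y) = - (x - y) by ring.
by rewrite normrN mul1r.
Qed.

(** * The exponential tail of the partial sums *)

(** Both consequences of the functional equation used for size estimates: an upper
bound on |G_N| valid for every N, and a lower bound on G_N once N x >= 1. *)
Lemma g_partial_recursion (R : realType) : exists2 C : R, 0 <= C &
  forall x : R, irrational01 x -> forall N : nat,
  let y := x * `|g_partial (gauss_map x) (Num.trunc (N%:R * x))| in
  `|g_partial x N| <= C - ln x + y /\
  ((0 < Num.trunc (N%:R * x))%N -> - ln x - C - y <= g_partial x N).
Proof.
have [C C0 HC] := g_partial_functional_equation R.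
exists (2 * C + 3) => [|x xI N y]; first by rewrite addr_ge0 ?mulr_ge0.
have [/andP[x0 x1] _] := xI.
have y0 : 0 <= y by rewrite mulr_ge0 // ltW.
have lx : ln x <= 0 by rewrite ln_le0 // ltW.
have [L LC /(_ N _ erefl)] := HC x xI.
have [M0 _|Mpos /(_ isT) H] := posnP (Num.trunc (N%:R * x)).
  by split => [|//]; have := g_partial_small xI M0; lra.
have CM : C / (Num.trunc (N%:R * x))%:R <= C by rewrite ler_pdivrMr ?ltr0n // ler_peMr // ler1n.
have yE : `|x * g_partial (gauss_map x) (Num.trunc (N%:R * x))| = y.
  by rewrite normrM (ger0_norm (ltW x0)).
have := ler_norm (x * g_partial (gauss_map x) (Num.trunc (N%:R * x))).
have := ler_norm (- (x * g_partial (gauss_map x) (Num.trunc (N%:R * x)))).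
rewrite normrN yE; move: (le_trans H CM) LC.
set z := x * _; rewrite !ler_norml => /andP[h1 h2] /andP[h3 h4] h5 h6.
by split => [|_]; [apply/andP; split; lra|lra].
Qed.

Definition tail_upto (R : realType) (N : nat) (y : R) : set R :=
  [set x | irrational01 x /\ exists2 n, (n <= N)%N & y < `|g_partial x n|].

Lemma lebesgue_irrational01_sub (R : realType) (A : set R) : A `<=` @irrational01 R ->
  (lebesgue_measure A <= 1)%E.
Proof.
move=> AI; apply: (@le_trans _ _ (lebesgue_measure (`]0, 1[%classic : set R))).
  by apply: lebesgue_le => x /AI [x01 _]; rewrite /= in_itv.
by rewrite lebesgue_measure_itv /= lte_fin ltr01 oppr0 adde0.
Qed.

Lemma truncV_bounds (R : realType) (x : R) : 0 < x ->
  (Num.trunc x^-1)%:R * x <= 1 /\ 1 < (Num.trunc x^-1).+1%:R * x.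
Proof.
move=> x0; have /truncn_itv/andP[h1 h2] : 0 <= x^-1 by rewrite invr_ge0 ltW.
split; first by rewrite -ler_pdivlMr // mul1r.
by rewrite -ltr_pdivrMr // mul1r.
Qed.

(** The threshold is multiplied by n because x <= 1/n damps the value at the
Gauss image; the number of admissible partial sums drops because N x < N. *)
Lemma tail_upto_recursion (R : realType) (C : R) :
  (forall x : R, irrational01 x -> forall N : nat,
    `|g_partial x N| <= C - ln x + x * `|g_partial (gauss_map x) (Num.trunc (N%:R * x))|) ->
  forall (N : nat) (y x : R), tail_upto N.+1 y x ->
  let n := Num.trunc x^-1 in
  tail_upto N (n%:R * (y - C - ln n.+1%:R)) (gauss_map x).
Proof.
move=> HC N y x [xI [k kN yk]] n; have [/andP[x0 x1] _] := xI.
have [nx nx1] := truncV_bounds x0; rewrite -/n in nx nx1.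
split; first exact: irrational01_gauss.
exists (Num.trunc (k%:R * x)).
  case: k kN yk => [|k kN _]; first by rewrite mul0r truncn0.
  rewrite -ltnS; apply: leq_trans kN.
  by rewrite truncn_lt_nat ?mulr_ge0 ?(ltW x0) // gtr_pMr // ltr0n.
have := lt_le_trans yk (HC x xI k).
set G := `|_|; have G0 : 0 <= G by exact: normr_ge0.
have lnx : - ln x <= ln n.+1%:R.
  by rewrite -lnV ?posrE // ler_ln ?posrE ?invr_gt0 ?ltr0n // -[_^-1]mul1r ler_pdivrMr // ltW.
move=> h; apply: (@lt_le_trans _ _ (n%:R * (x * G))).
  rewrite ltr_pM2l; first lra.
  by rewrite ltr0n /n truncn_gt0 invf_ge1 // ltW.
by rewrite mulrA ler_piMl.
Qed.

(** Trades all but two powers of t for a geometric factor, so that the sums over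
branches converge while keeping the gain t^2. *)
Lemma expr_le_half (R : realFieldType) (t : R) (n : nat) : 0 <= t <= 2^-1 -> (2 <= n)%N ->
  t ^+ n <= 4 * t ^+ 2 * 2^-1 ^+ n.
Proof.
move=> /andP[t0 t1]; case: n => [//|[//|n _]].
rewrite -addn2 !exprD mulrC.
have -> : 4 * t ^+ 2 * (2^-1 ^+ n * 2^-1 ^+ 2) = t ^+ 2 * 2^-1 ^+ n by field.
by rewrite ler_wpM2l ?exprn_ge0 // lerXn2r ?nnegrE // ?invr_ge0.
Qed.

Lemma tail_upto_sum_le (R : realType) (A w : R) (P : nat) : 0 <= A -> 0 <= w -> P%:R * w <= 2^-1 ->
  \sum_(2 <= n < P) (A * (n.+1%:R * w) ^+ n) / n%:R ^+ 2 <= 9 / 2 * (A * w ^+ 2).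
Proof.
move=> A0 w0 Pw.
have Aw : 0 <= A * w ^+ 2 by rewrite mulr_ge0 ?exprn_ge0.
have [P2|P2] := ltnP P 2; first by rewrite big_geq ?mulr_ge0 // ltnW.
apply: (@le_trans _ _ (\sum_(2 <= n < P) (- (18 * (A * w ^+ 2) * 2^-1 ^+ n.+1)
   - - (18 * (A * w ^+ 2) * 2^-1 ^+ n)))).
  rewrite !big_nat; apply: ler_sum => n /andP[n2 nP].
  have n0 : 2 <= n%:R :> R by rewrite ler_nat.
  have h : 0 <= n.+1%:R * w <= 2^-1.
    rewrite mulr_ge0 //=; apply: le_trans Pw.
    by rewrite ler_wpM2r // ler_nat.
  rewrite ler_pdivrMr ?exprn_gt0 //; last lra.
  apply: (le_trans (ler_wpM2l A0 (expr_le_half h n2))).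
  rewrite [2^-1 ^+ n.+1]exprS -[n.+1%:R]natr1.
  have e0 : 0 <= 2^-1 ^+ n :> R by rewrite exprn_ge0 // invr_ge0.
  have -> : A * (4 * ((n%:R + 1) * w) ^+ 2 * 2^-1 ^+ n) =
    (A * w ^+ 2 * 2^-1 ^+ n) * (4 * (n%:R + 1) ^+ 2) by ring.
  have -> : (- (18 * (A * w ^+ 2) * (2^-1 * 2^-1 ^+ n)) - - (18 * (A * w ^+ 2) * 2^-1 ^+ n)) * n%:R ^+ 2
     = (A * w ^+ 2 * 2^-1 ^+ n) * (9 * n%:R ^+ 2) by field.
  by rewrite ler_wpM2l ?mulr_ge0 //; nra.
rewrite telescope_sumr //.
have : 0 <= 18 * (A * w ^+ 2) * 2^-1 ^+ P.
  by rewrite mulr_ge0 ?exprn_ge0 ?invr_ge0 ?mulr_ge0.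
have -> : 18 * (A * w ^+ 2) * 2^-1 ^+ 2 = 9 / 2 * (A * w ^+ 2) by field.
lra.
Qed.

(** Induction on [N] with the same constant [A] throughout; this is possible
because the branches with n >= 2 give back a multiple of exp(-y) that does not
involve [A]. *)
Lemma lebesgue_tail_upto (R : realType) : exists2 A : R, 0 < A &
  forall N y, (lebesgue_measure (tail_upto N y) <= (A * expR (- y))%:E)%E.
Proof.
have [C C0 HC0] := g_partial_recursion R.
have HC (x : R) : irrational01 x -> forall N : nat,
    `|g_partial x N| <= C - ln x + x * `|g_partial (gauss_map x) (Num.trunc (N%:R * x))|.
  by move=> xI N; have [] := HC0 x xI N.
set q := expR C; have q1 : 1 <= q by rewrite /q -expR0 ler_expR.
(* The cut-off at 1/P costs 8 w and the branches 9 q w, where w = q exp(-y);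
   A >= 12 q forces w <= 1/12. *)
pose A := q * (12 + 9 * q).
have A12 : 12 * q <= A by rewrite /A; nra.
exists A; first by lra.
have tailI N y : @tail_upto R N y `<=` @irrational01 R by move=> x [].
elim=> [|N IHN] y.
(* When A exp(-y) >= 1 the bound is that of the whole interval. *)
all: have [Ay|Ay] := leP 1 (A * expR (- y));
  first by apply: (le_trans (lebesgue_irrational01_sub (@tailI _ _))); rewrite lee_fin.
all: have ey0 := expR_gt0 (- y).
all: have y0 : 0 < y by rewrite -oppr_lt0 -expR_lt1; nra.
  rewrite (_ : tail_upto 0 y = set0) ?measure0 ?lee_fin ?mulr_ge0 ?expR_ge0 //; first lra.
  rewrite -subset0 => x [_ [[|//] _]].
  by rewrite /g_partial big_geq // normr0; lra.
set w := q * expR (- y).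
have w0 : 0 < w by rewrite mulr_gt0 //; lra.
have Aw : A * w <= q.
  have -> : A * w = q * (A * expR (- y)) by rewrite /w; ring.
  by rewrite ler_piMr //; lra.
have w12 : 12 * w <= 1.
  have : q * (12 * w) <= q * 1 by nra.
  by rewrite ler_pM2l //; lra.
have w20 : 0 < 2 * w by lra.
(* The branches n < P are those on which (n + 1) w <= 1/2. *)
set P := Num.trunc (2 * w)^-1; have [Pw1 Pw2] := truncV_bounds w20.
rewrite -/P -[P.+1%:R]natr1 in Pw1 Pw2.
have P0 : 0 < P%:R :> R by nra.
have PV : P%:R^-1 <= 4 * w.
  by rewrite -[_^-1]mul1r ler_pdivrMr //; nra.
set Q := tail_upto N.+1 y.
have Qsym x : Q x -> Q (1 - x).
  move=> [xI [n nN yn]]; split; first exact: irrational01_1B.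
  by exists n => //; rewrite g_partial_odd // normrN.
apply: (le_trans (lebesgue_symmetric (@tailI N.+1 y) Qsym)).
have step : (lebesgue_measure (Q `&` [set x : R | (x < 2^-1)%R]) <=
  (P%:R^-1 + \sum_(2 <= n < P) (A * (n.+1%:R * w) ^+ n) / n%:R ^+ 2)%:E)%E.
  apply: (@lebesgue_gauss_branches _ _ _
    (fun n => tail_upto N (n%:R * (y - C - ln n.+1%:R))) _ _ _ _ _ _ (fun n => @tailI N _)) => //.
  - by move=> x [[]].
  - move=> n _; apply: (le_trans (IHN _)); rewrite lee_fin.
    rewrite -mulrN expRM_natl.
    have -> : - (y - C - ln n.+1%:R) = C - y + ln n.+1%:R :> R by ring.
    by rewrite !expRD lnK ?posrE ?ltr0n // [X in X ^+ n]mulrC.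
  move=> x [Qx xh]; have [[/andP[x0 x1] _] _] := Qx.
  have [nx nx1] := truncV_bounds x0.
  have [nP|Pn] := ltnP (Num.trunc x^-1) P; [right|left].
    split; last exact: tail_upto_recursion HC _ _ _ Qx.
    rewrite andbT truncn_ge_nat ?invr_ge0 ?(ltW x0) //.
    by rewrite -[_^-1]mul1r ler_pdivlMr //; move: xh => /=; lra.
  rewrite -[leRHS]mul1r ler_pdivlMr // mulrC; apply: le_trans nx.
  by rewrite ler_pM2r // ler_nat.
apply: (@le_trans _ _ (2%:E * (P%:R^-1 + \sum_(2 <= n < P) (A * (n.+1%:R * w) ^+ n) / n%:R ^+ 2)%:E)%E).
  by rewrite lee_pmul2l.
rewrite -EFinM lee_fin.
have A0 : 0 <= A by lra.
have PP : P%:R * w <= 2^-1 by lra.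
have := tail_upto_sum_le A0 (ltW w0) PP.
set S := \sum_(_ <= _ < _) _ => HS.
have Aw2 : A * w ^+ 2 <= q * w by rewrite expr2 mulrA ler_pM2r.
have -> : A * expR (- y) = (12 + 9 * q) * w by rewrite /A /w; ring.
nra.
Qed.

(** * Almost everywhere convergence *)

Lemma measurable_frac_part (R : realType) : measurable_fun [set: R] (@frac_part R).
Proof.
apply: measurable_funB; first exact: measurable_id.
apply: nondecreasing_measurable => // x y xy.
by rewrite ler_int le_floor.
Qed.

Lemma measurable_g_partial (R : realType) (N : nat) :
  measurable_fun [set: R] (fun x : R => g_partial x N).
Proof.
apply: measurable_sum => l; apply: measurable_funM => //.
apply: measurable_funB => //; apply: measurable_funM => //.
apply: (measurableT_comp (@measurable_frac_part R)).
by apply: measurable_funM.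
Qed.

Lemma measurable_lt_norm (R : realType) (f : R -> R) (y : R) :
  measurable_fun [set: R] f -> measurable [set x | y < `|f x|].
Proof.
move=> mf; have mn : measurable_fun [set: R] (fun x => `|f x|).
  exact: (measurableT_comp (@normr_measurable R setT) mf).
have := mn measurableT `]y, +oo[%classic (measurable_itv _).
by rewrite setTI; congr measurable; apply/seteqP; split => x /=; rewrite in_itv /= andbT.
Qed.

Definition rational_in01 (R : realType) : set R :=
  `]0, 1[%classic `\` @irrational01 R.

Lemma countable_rational_in01 (R : realType) : countable (@rational_in01 R).
Proof.
apply: (@sub_countable _ _ _ [set (p.2%:R : R) / p.1%:R | p in [set: nat * nat]]).
  apply: subset_card_le => x [/= x01 xI].
  have /existsNP[l /existsNP[m /not_implyP[l0 /negP]]] :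
      ~ forall l m : nat, (0 < l)%N -> l%:R * x != m%:R.
    by move=> h; apply: xI; split => //; move: x01; rewrite in_itv.
  rewrite negbK => /eqP e; exists (l, m) => //=.
  by rewrite -e mulrC mulKf // pnatr_eq0 -lt0n.
by apply: (sub_countable (card_image_le _ _)); exact: countableP.
Qed.

Lemma measurable_irrational01 (R : realType) : measurable (@irrational01 R).
Proof.
have -> : @irrational01 R = `]0, 1[%classic `\` @rational_in01 R.
  rewrite /rational_in01 setDD; apply/seteqP; split => [x xI|x []//].
  by split => //=; rewrite in_itv /=; case: xI.
apply: measurableD => //; apply: countable_measurable => //.
exact: countable_rational_in01.
Qed.

Lemma measurable_tail_upto (R : realType) (N : nat) (y : R) : measurable (tail_upto N y).
Proof.
rewrite (_ : tail_upto N y = @irrational01 R `&`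
    \bigcup_(n in [set n | (n <= N)%N]) [set x | y < `|g_partial x n|]).
  apply: measurableI; first exact: measurable_irrational01.
  apply: bigcup_measurable => n _; apply: measurable_lt_norm.
  exact: measurable_g_partial.
by apply/seteqP; split => x [xI [n nN yn]]; split => //; exists n.
Qed.

Definition tail (R : realType) (y : R) : set R :=
  [set x | irrational01 x /\ exists n, y < `|g_partial x n|].

(** The bound for finitely many partial sums is uniform, so it passes to the increasing union. *)
Lemma lebesgue_tail (R : realType) : exists2 A : R, 0 < A &
  forall y, (lebesgue_measure (tail y) <= (A * expR (- y))%:E)%E.
Proof.
have [A A0 HA] := lebesgue_tail_upto R; exists A => // y.
have -> : tail y = \bigcup_N tail_upto N y.
  apply/seteqP; split => x [].
    by move=> xI [n yn]; exists n => //; split => //; exists n.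
  by move=> N _ [xI [n _ yn]]; split => //; exists n.
have nd : {homo (fun N => tail_upto N y) : n m / (n <= m)%N >-> (n <= m)%O}.
  move=> n m nm; apply/subsetPset => x [xI [k kn yk]]; split => //; exists k => //.
  exact: leq_trans nm.
have mt N := measurable_tail_upto N y.
have h := nondecreasing_cvg_mu (mu := @lebesgue_measure R) mt (bigcupT_measurable _ mt) nd.
rewrite -(cvg_lim _ h) //; apply: lime_le; first exact: cvgP h.
by apply: nearW => N; exact: HA.
Qed.

(** Stands for a gap of about [y] between the limsup and the liminf of the partial
sums, in a form whose measurability is visible and which passes through the
functional equation with the same [y]. *)
Definition oscillating (R : realType) (y : R) : set R :=
  [set x | irrational01 x /\ forall K, exists i j,
    y < `|g_partial x (K + i) - g_partial x (K + j)|].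

Lemma measurable_oscillating (R : realType) (y : R) : measurable (oscillating y).
Proof.
rewrite (_ : oscillating y = @irrational01 R `&` \bigcap_K \bigcup_i \bigcup_j
  [set x | y < `|g_partial x (K + i) - g_partial x (K + j)|]).
  apply: measurableI; first exact: measurable_irrational01.
  apply: bigcapT_measurable => K; apply: bigcupT_measurable => i.
  apply: bigcupT_measurable => j; apply: measurable_lt_norm.
  by apply: measurable_funB; exact: measurable_g_partial.
apply/seteqP; split => x [xI H]; split => // K.
  by move=> _; have [i [j ij]] := H K; exists i => //; exists j.
by have [i _ [j _ ij]] := H K I; exists i, j.
Qed.

(** Subtract the functional equation at two large indices: L and ln x cancel, and
the difference at x is x times the one at the Gauss image, up to O(1/M).  The
strict inequality n x < 1 absorbs that error, so no part of the threshold is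
lost. *)
Lemma oscillating_gauss (R : realType) (y x : R) : 0 < y -> oscillating y x ->
  oscillating ((Num.trunc x^-1)%:R * y) (gauss_map x).
Proof.
move=> y0 [xI osc]; have [/andP[x0 x1] xirr] := xI.
have [nx _] := truncV_bounds x0; set n := Num.trunc x^-1 in nx *.
have nx1 : n%:R * x < 1.
  rewrite lt_neqAle nx andbT; have := xirr n 1%N.
  by rewrite /n truncn_gt0 invf_ge1 // ltW //; apply.
split => [|K]; first exact: irrational01_gauss.
have [C C0 /(_ x xI)[L _ HL]] := g_partial_functional_equation R.
have s0 : 0 < y * (1 - n%:R * x) by rewrite mulr_gt0 // subr_gt0.
(* Beyond M0 the two errors C/M together are below the room y (1 - n x). *)
pose M0 := (maxn K (Num.trunc (2 * C / (y * (1 - n%:R * x))))).+1.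
have CM0 : 2 * C / M0%:R <= y * (1 - n%:R * x).
  rewrite ler_pdivrMr ?ltr0n // [leRHS]mulrC -ler_pdivrMr // ltW //.
  apply: (lt_le_trans (truncnS_gt _)); rewrite ler_nat ltnS.
  exact: leq_maxr.
pose K' := (Num.trunc (M0%:R / x)).+1.
have KK' k : (K' <= k)%N -> (M0 <= Num.trunc (k%:R * x))%N.
  move=> kK; rewrite truncn_ge_nat ?mulr_ge0 ?(ltW x0) // -ler_pdivrMr // ltW //.
  by apply: (lt_le_trans (truncnS_gt _)); rewrite ler_nat.
have KM (k : nat) : (M0 <= k)%N -> exists i, k = (K + i)%N.
  move=> Mk; exists (k - K)%N; rewrite subnKC //.
  by apply: leq_trans Mk; rewrite /M0 leqW // leq_maxl.
have [i [j]] := osc K'.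
have Mi := KK' (K' + i)%N (leq_addr _ _); have Mj := KK' (K' + j)%N (leq_addr _ _).
have := HL (K' + i)%N _ erefl (leq_trans (ltn0Sn _) Mi).
have := HL (K' + j)%N _ erefl (leq_trans (ltn0Sn _) Mj).
have CM k : (M0 <= k)%N -> C / k%:R <= C / M0%:R.
  move=> Mk; rewrite ler_wpM2l // lef_pV2 ?posrE ?ltr0n ?ler_nat //.
  exact: leq_trans Mk.
move=> /le_trans /(_ (CM _ Mj)) + /le_trans /(_ (CM _ Mi)).
have [i' ei] := KM _ Mi; have [j' ej] := KM _ Mj.
rewrite ei ej.
set Gi := g_partial x (K' + i); set Gj := g_partial x (K' + j).
set Hi := g_partial _ (K + i'); set Hj := g_partial _ (K + j').
move=> hj hi hy; exists i', j'; rewrite -/Hi -/Hj.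
have e2 : 2 * C / M0%:R = C / M0%:R + C / M0%:R by rewrite -mulrA; ring.
have key : `|Gi - Gj| <= x * `|Hi - Hj| + 2 * C / M0%:R.
  have -> : x * `|Hi - Hj| = `|x * (Hi - Hj)| by rewrite normrM (ger0_norm (ltW x0)).
  have -> : Gi - Gj = (Gi + x * Hi + ln x - L) - (Gj + x * Hj + ln x - L) - x * (Hi - Hj) by ring.
  apply: (le_trans (ler_normB _ _)); rewrite addrC lerD2l e2.
  by apply: (le_trans (ler_normB _ _)); rewrite lerD.
have : n%:R * y * x < `|Hi - Hj| * x.
  move: (lt_le_trans hy key) CM0; set c := 2 * C / M0%:R.
  have -> : y * (1 - n%:R * x) = y - n%:R * y * x by ring.
  lra.
by rewrite ltr_pM2r.
Qed.

Lemma sum_inv_sqr_le (R : realType) (a : R) (m0 m1 : nat) : 0 <= a -> (2 <= m0)%N ->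
  \sum_(m0 <= n < m1) a / n%:R ^+ 2 <= a * (2 / m0%:R).
Proof.
move=> a0 m02; have m0R : 2 <= m0%:R :> R by rewrite ler_nat.
have [m10|m01] := ltnP m1 m0.
  by rewrite big_geq ?mulr_ge0 ?divr_ge0 // ltnW.
apply: (@le_trans _ _ (\sum_(m0 <= n < m1) (- (a * (n.+1%:R - 1)^-1) - - (a * (n%:R - 1)^-1)))).
  rewrite !big_nat; apply: ler_sum => n /andP[mn _].
  have : m0%:R <= n%:R :> R by rewrite ler_nat.
  rewrite -[n.+1%:R]natr1; set k := n%:R => mk.
  have -> : - (a * (k + 1 - 1)^-1) - - (a * (k - 1)^-1) = a / (k * (k - 1)).
    by field; apply/andP; split; lra.
  by rewrite ler_wpM2l // lef_pV2 ?posrE ?mulr_gt0 ?exprn_gt0 //; try lra; nra.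
rewrite telescope_sumr //.
have m1R : m0%:R <= m1%:R :> R by rewrite ler_nat.
have h1 : 0 <= a * (m1%:R - 1)^-1 by rewrite mulr_ge0 ?invr_ge0 //; lra.
have h2 : a * (m0%:R - 1)^-1 <= a * (2 / m0%:R).
  rewrite ler_wpM2l // ler_pdivlMr; last lra.
  by rewrite mulrC ler_pdivrMr; lra.
lra.
Qed.

(** On x < 1/2 the oscillation at the Gauss image is at least doubled, and the sum
of 1/n^2 over n >= 2 is at most 1; the factor 2 is the reflection x |-> 1 - x. *)
Lemma oscillating_double (R : realType) (y c : R) : 0 < y -> 0 <= c ->
  (lebesgue_measure (oscillating (2 * y)) <= c%:E)%E ->
  (lebesgue_measure (oscillating y) <= (2 * c)%:E)%E.
Proof.
move=> y0 c0 Hc.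
have oI z : @oscillating R z `<=` @irrational01 R by move=> x [].
have osym x : oscillating y x -> oscillating y (1 - x).
  move=> [xI H]; split; first exact: irrational01_1B.
  move=> K; have [i [j ij]] := H K; exists i, j.
  by rewrite !g_partial_odd // -opprD normrN.
apply: (le_trans (lebesgue_symmetric (oI y) osym)); rewrite EFinM.
rewrite lee_pmul2l //; apply/lee_addgt0Pr => e e0.
pose P := (Num.trunc e^-1).+2.
have PV : P%:R^-1 <= e.
  rewrite -[leRHS]invrK lef_pV2 ?posrE ?invr_gt0 ?ltr0n // ltW //.
  by apply: (lt_trans (truncnS_gt _)); rewrite ltr_nat.
apply: (@le_trans _ _ ((P%:R^-1 + \sum_(2 <= n < P) c / n%:R ^+ 2)%:E)%E).
  apply: (@lebesgue_gauss_branches _ _ _ (fun n => oscillating (2 * y)) (fun=> c)) => //.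
    by move=> x [[]].
  move=> x [[xI H] xh]; have [/andP[x0 x1] _] := xI.
  have [nx nx1] := truncV_bounds x0.
  have [nP|Pn] := ltnP (Num.trunc x^-1) P; [right|left].
    have n2 : (1 < Num.trunc x^-1)%N.
      rewrite truncn_ge_nat ?invr_ge0 ?(ltW x0) //.
      by rewrite -[_^-1]mul1r ler_pdivlMr //; move: xh => /=; lra.
    split; first by rewrite n2.
    have [gI {}H] := oscillating_gauss y0 (conj xI H).
    split => // K; have [i [j ij]] := H K; exists i, j.
    by apply: le_lt_trans ij; rewrite ler_pM2r // ler_nat.
  rewrite -[leRHS]mul1r ler_pdivlMr // mulrC; apply: le_trans nx.
  by rewrite ler_pM2r // ler_nat.
rewrite -EFinD lee_fin addrC lerD //.
by apply: (le_trans (sum_inv_sqr_le P c0 (leqnn 2))); rewrite divff // mulr1.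
Qed.

Lemma lebesgue_oscillating (R : realType) (y : R) : 0 < y ->
  lebesgue_measure (oscillating y) = 0%E.
Proof.
move=> y0; have [A A0 HA] := lebesgue_tail R.
have iter j (z : R) : 0 < z ->
    (lebesgue_measure (oscillating z) <= (2 ^+ j * (A * expR (- (2 ^+ j * z / 2))))%:E)%E.
  elim: j z => [z z0|j IHj z z0].
    rewrite expr0 !mul1r; apply: le_trans (HA _); apply: lebesgue_le.
    move=> x [xI /(_ 0%N)[i [j zij]]]; split => //.
    have [h|h] := ltP (z / 2) `|g_partial x (0 + i)|; first by exists (0 + i)%N.
    exists (0 + j)%N; have := ler_normB (g_partial x (0 + i)) (g_partial x (0 + j)); lra.
  rewrite exprS -mulrA; apply: oscillating_double => //.
    by rewrite mulr_ge0 ?exprn_ge0 // mulr_ge0 ?expR_ge0 // ltW.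
  have := IHj (2 * z); rewrite mulr_gt0 // => /(_ isT).
  by rewrite -!mulrA (mulrCA (2 ^+ j) 2).
apply/eqP; rewrite eq_le measure_ge0 andbT; apply/lee_addgt0Pr => e e0; rewrite add0e.
pose j := (Num.trunc (8 * A / (e * y ^+ 2))).
apply: (le_trans (iter j y y0)); rewrite lee_fin.
set t := 2 ^+ j * y / 2.
have p0 : 0 < 2 ^+ j :> R by rewrite exprn_gt0.
have t0 : 0 < t by rewrite /t divr_gt0 // mulr_gt0.
have et : expR (- t) <= 2 / t ^+ 2.
  rewrite expRN -[leRHS]invrK lef_pV2 ?posrE ?expR_gt0 ?invr_gt0 ?divr_gt0 ?exprn_gt0 //.
  have := expR_ge1Dxn 1 (ltW t0); rewrite invf_div (_ : (2`!)%:R = 2) //; lra.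
have h : 8 * A / (e * y ^+ 2) <= 2 ^+ j.
  apply: ltW; apply: (lt_le_trans (truncnS_gt _)); rewrite -/j -natrX ler_nat.
  by rewrite ltn_expl.
apply: (@le_trans _ _ (2 ^+ j * (A * (2 / t ^+ 2)))).
  by rewrite ler_pM2l // ler_pM2l.
have -> : 2 ^+ j * (A * (2 / t ^+ 2)) = 8 * A / y ^+ 2 / 2 ^+ j.
  by rewrite /t; field; apply/andP; split; lra.
rewrite ler_pdivrMr // -ler_pdivrMl //.
by have -> : e^-1 * (8 * A / y ^+ 2) = 8 * A / (e * y ^+ 2) by field; apply/andP; split; lra.
Qed.

Definition divergent (R : realType) : set R := \bigcup_k oscillating (k.+1%:R^-1).

Lemma lebesgue_divergent (R : realType) : lebesgue_measure (@divergent R) = 0%E.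
Proof.
apply/eqP; rewrite eq_le measure_ge0 andbT; apply: (le_trans (lebesgue_sub_bigcup _)).
by rewrite eseries0 // => k _ _; rewrite lebesgue_oscillating // invr_gt0.
Qed.

Lemma divergent_cvgP (R : realType) (x : R) : irrational01 x ->
  ~ divergent x <-> cvgn (g_partial x).
Proof.
move=> xI; split=> [xD|/cvg_ex[l gl] [k _ [_ H]]].
  apply/cauchy_cvgP/cauchy_exP => e e0.
  pose k := Num.trunc e^-1.
  have ke : k.+1%:R^-1 < e.
    rewrite -[ltRHS]invrK ltf_pV2 ?posrE ?invr_gt0 ?ltr0n //; exact: truncnS_gt.
  have : ~ oscillating k.+1%:R^-1 x by move=> H; apply: xD; exists k.
  move=> /not_andP[//|/existsNP[K HK]].
  exists (g_partial x K); exists K => // n /= Kn.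
  rewrite -ball_normE /=; apply: le_lt_trans ke; rewrite leNgt; apply/negP => h.
  by apply: HK; exists 0%N, (n - K)%N; rewrite addn0 subnKC.
have e0 : 0 < k.+1%:R^-1 / 2 :> R by rewrite divr_gt0 // invr_gt0.
have [K _ HK] := (@cvgrPdist_lt _ _ _ _ _ _ _).1 gl _ e0.
have [i [j]] := H K.
have h1 : `|l - g_partial x (K + i)| < k.+1%:R^-1 / 2 := HK (K + i)%N (leq_addr _ _).
have h2 : `|l - g_partial x (K + j)| < k.+1%:R^-1 / 2 := HK (K + j)%N (leq_addr _ _).
have -> : g_partial x (K + i) - g_partial x (K + j) =
  (l - g_partial x (K + j)) - (l - g_partial x (K + i)) by ring.
have h3 := ler_normB (l - g_partial x (K + j)) (l - g_partial x (K + i)).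
rewrite ltNge => /negP; apply; apply: (le_trans h3).
by move: h1 h2; set a := `|_|; set b := `|_|; set e := k.+1%:R^-1; lra.
Qed.

Lemma measurable_divergent (R : realType) : measurable (@divergent R).
Proof. by apply: bigcupT_measurable => k; exact: measurable_oscillating. Qed.

Lemma measurable_fun_countable (R : realType) (D : set R) (f : R -> R) :
  countable D -> measurable_fun D f.
Proof.
move=> cD _ Y _; apply: countable_measurable => //.
by apply: sub_countable cD; apply: subset_card_le; exact: subIsetl.
Qed.

(** At points of divergence [g] takes the default value of [lim], which is one
fixed real number; so [g] is a pointwise limit on one measurable set, constant
on another, and the rest of (0, 1) is countable. *)
Lemma measurable_g (R : realType) : measurable_fun (`]0, 1[%classic : set R) (@g R).
Proof.
have mI := @measurable_irrational01 R; have mD := @measurable_divergent R.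
have mQ : measurable (@rational_in01 R).
  by apply: countable_measurable => //; exact: countable_rational_in01.
have -> : `]0, 1[%classic = @rational_in01 R `|`
    ((@irrational01 R `&` @divergent R) `|` (@irrational01 R `\` @divergent R)).
  apply/seteqP; split => [x x01|x [[]//|[[[x01 _] _]|[[x01 _] _]]]]; rewrite /= ?in_itv //.
  have [xI|xQ] := pselect (irrational01 x); last by left.
  by right; have [xD|xD] := pselect (divergent x); [left|right].
have mID : measurable (@irrational01 R `&` @divergent R) by exact: measurableI.
have mIC : measurable (@irrational01 R `\` @divergent R) by exact: measurableD.
apply/measurable_funU => //; first exact: measurableU.
split; first by apply: measurable_fun_countable; exact: countable_rational_in01.
apply/measurable_funU => //; split.
  apply: (eq_measurable_fun (fun=> point : R)) => [x|]; last exact: measurable_cst.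
  rewrite inE => -[xI xD]; rewrite /g dvgP // => /(divergent_cvgP xI).
  by apply.
apply: (@measurable_fun_cvg _ _ _ _ (fun N x => g_partial x N)).
  by move=> N; apply: measurable_funTS; exact: measurable_g_partial.
by move=> x [xI /(divergent_cvgP xI)].
Qed.

(** * Euler's integral cut into unit layers *)

Lemma integral_layers_le d (T : measurableType d) (R : realType) (mu : {measure set T -> \bar R})
    (D : set T) (F : (set T)^nat) (f : T -> \bar R) (c m : nat -> R) :
  (forall j, measurable (F j)) -> trivIset setT F -> D = \bigcup_j F j ->
  measurable_fun D f -> (forall x, D x -> (0 <= f x)%E) -> (forall j, 0 <= c j) ->
  (forall j x, F j x -> (f x <= (c j)%:E)%E) -> (forall j, (mu (F j) <= (m j)%:E)%E) ->
  (\int[mu]_(x in D) f x <= \sum_(j <oo) (c j * m j)%:E)%E.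
Proof.
move=> mF tF -> mf f0 c0 fc Fm; rewrite ge0_integral_bigcup //.
apply: lee_nneseries => [j _ _|j _].
  by apply: integral_ge0 => x Fx; apply: f0; exists j.
have mfj : measurable_fun (F j) f.
  apply: (measurable_funS _ _ mf); last exact: bigcup_sup.
  exact: bigcupT_measurable.
apply: (@le_trans _ _ (\int[mu]_(x in F j) cst (c j)%:E x)%E).
  apply: ge0_le_integral => //; last exact: fc.
  by move=> x Fx; apply: f0; exists j.
by rewrite integral_cst // EFinM lee_wpmul2l // lee_fin.
Qed.

Lemma integral_layers_ge d (T : measurableType d) (R : realType) (mu : {measure set T -> \bar R})
    (D : set T) (F : (set T)^nat) (f : T -> \bar R) (c m : nat -> R) :
  measurable D -> (forall j, measurable (F j)) -> trivIset setT F -> \bigcup_j F j `<=` D ->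
  measurable_fun D f -> (forall x, D x -> (0 <= f x)%E) ->
  (forall j, 0 <= c j) -> (forall j, 0 <= m j) ->
  (forall j x, F j x -> ((c j)%:E <= f x)%E) -> (forall j, ((m j)%:E <= mu (F j))%E) ->
  (\sum_(j <oo) (c j * m j)%:E <= \int[mu]_(x in D) f x)%E.
Proof.
move=> mD mF tF FD mf f0 c0 m0 cf mFj.
have mU := bigcupT_measurable F mF.
have mfU : measurable_fun (\bigcup_j F j) f by exact: (measurable_funS _ _ mf).
apply: (@le_trans _ _ (\int[mu]_(x in \bigcup_j F j) f x)%E); last first.
  exact: ge0_subset_integral.
rewrite ge0_integral_bigcup //; last by move=> x /FD; exact: f0.
apply: lee_nneseries => [j _ _|j _]; first by rewrite lee_fin mulr_ge0.
have mfj : measurable_fun (F j) f.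
  by apply: (measurable_funS _ _ mfU) => //; exact: bigcup_sup.
apply: (@le_trans _ _ (\int[mu]_(x in F j) cst (c j)%:E x)%E).
  by rewrite integral_cst // EFinM lee_wpmul2l // lee_fin.
apply: ge0_le_integral => //; last exact: cf.
by move=> x _; rewrite lee_fin.
Qed.

(** The common yardstick: it is within constant factors of both Euler's integral
and the moment of [g], so that the value of neither is needed. *)
Definition moment_series (R : realType) (p : nat) : \bar R :=
  (\sum_(j <oo) (j.+1%:R ^+ p * expR (- j%:R))%:E)%E.

(** Needed because [Gamma] reads an infinite integral as 0.  The exponential beats
the power j^(p+2), which leaves the sum of 1/j^2. *)
Lemma moment_series_lty (R : realType) (p : nat) : (moment_series R p < +oo)%E.
Proof.
pose c : R := expR 1 * (p.+2)`!%:R.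
have c0 : 0 <= c by rewrite mulr_ge0 ?expR_ge0.
have termle (j : nat) : j.+1%:R ^+ p * expR (- j%:R) <= c / j.+1%:R ^+ 2 :> R.
  have j0 : 0 <= j.+1%:R :> R by [].
  have jp : 0 < j.+1%:R :> R by rewrite ltr0n.
  have h := expR_ge1Dxn p.+1 j0.
  have -> : expR (- j%:R) = expR 1 / expR j.+1%:R :> R.
    by rewrite -expRB; congr expR; rewrite -[j.+1%:R]natr1 opprD addrCA subrr addr0.
  rewrite /c ler_pdivlMr ?exprn_gt0 //.
  have -> : j.+1%:R ^+ p * (expR 1 / expR j.+1%:R) * j.+1%:R ^+ 2 =
    expR 1 * (j.+1%:R ^+ p.+2 / expR j.+1%:R) :> R.
    by rewrite -[p.+2]addn2 exprD; ring.
  rewrite ler_pM2l ?expR_gt0 // ler_pdivrMr ?expR_gt0 // mulrC -ler_pdivrMr ?ltr0n ?fact_gt0 //.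
  by apply: le_trans h; rewrite lerDr.
apply: (@le_lt_trans _ _ (2 * c)%:E); last by rewrite ltry.
apply: lime_le.
  by apply: is_cvg_nneseries => j _ _; rewrite lee_fin mulr_ge0 ?exprn_ge0 ?expR_ge0.
apply: nearW => m; rewrite sumEFin lee_fin.
apply: (@le_trans _ _ (\sum_(0 <= j < m) c / j.+1%:R ^+ 2)).
  by apply: ler_sum => j _; exact: termle.
case: m => [|m]; first by rewrite big_geq // mulr_ge0.
rewrite big_nat_recl // expr1n divr1.
have := sum_inv_sqr_le m.+2 c0 (leqnn 2); rewrite divff // mulr1.
rewrite (big_addn 0 m.+2 2) => h.
have -> : \sum_(0 <= i < m) c / i.+2%:R ^+ 2 = \sum_(0 <= i < m.+2 - 2) c / (i + 2)%:R ^+ 2.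
  by rewrite subn2 /=; apply: eq_bigr => i _; rewrite addn2.
lra.
Qed.

Lemma trivIset_itvoc (R : realType) :
  trivIset setT (fun j : nat => `]j%:R, j.+1%:R]%classic : set R).
Proof.
apply/trivIsetP => i j _ _ /eqP ij; rewrite -subset0 => x [] /=.
rewrite !in_itv /= => /andP[ix xi] /andP[jx xj]; apply: ij; apply/eqP.
have := lt_le_trans ix xj; have := lt_le_trans jx xi; rewrite !ltr_nat !ltnS => ji {}ij.
by rewrite eqn_leq ij ji.
Qed.

Definition euler_integral (R : realType) (p : nat) : \bar R :=
  (\int[@lebesgue_measure R]_(t in `]0%R, +oo[) (t ^+ p * expR (- t))%:E)%E.

Lemma euler_integrand_measurable (R : realType) (p : nat) (D : set R) :
  measurable_fun D (fun t : R => (t ^+ p * expR (- t))%:E).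
Proof.
apply/measurable_EFinP; apply: measurable_funTS; apply: measurable_funM.
  exact: exprn_measurable.
by apply: measurableT_comp => //; exact: measurable_expR.
Qed.

Lemma lebesgue_unit_itvoc (R : realType) (j : nat) :
  lebesgue_measure (`]j%:R, j.+1%:R]%classic : set R) = 1%E.
Proof.
rewrite lebesgue_measure_itv /= lte_fin ltr_nat ltnSn -EFinB; congr EFin.
by rewrite -[j.+1%:R]natr1 addrAC subrr add0r.
Qed.

Lemma euler_integral_le (R : realType) (p : nat) : (euler_integral R p <= moment_series R p)%E.
Proof.
have -> : moment_series R p =
    (\sum_(j <oo) ((j.+1%:R ^+ p * expR (- j%:R)) * 1 : R)%:E)%E.
  by apply: eq_eseriesr => j _; rewrite mulr1.
apply: (@integral_layers_le _ _ _ (@lebesgue_measure R) _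
  (fun j : nat => `]j%:R, j.+1%:R]%classic : set R) _
  (fun j : nat => j.+1%:R ^+ p * expR (- j%:R)) (fun=> 1)) => //.
- exact: trivIset_itvoc.
- apply/seteqP; split => [x /=|x [j _] /=]; rewrite !in_itv /= ?andbT.
    move=> x0; pose n := Num.trunc x.
    have /andP[nx xn] := truncn_itv (ltW x0).
    have [e|ne] := eqVneq x n%:R.
      have n0 : (0 < n)%N by rewrite -(ltr0n R) -e.
      exists n.-1 => //=; rewrite in_itv /= prednK // e lexx andbT ltr_nat.
      by rewrite ltn_predL.
    by exists n => //=; rewrite in_itv /= (ltW xn) andbT lt_neqAle eq_sym ne.
  by move=> /andP[jx _]; apply: le_lt_trans jx.
- exact: euler_integrand_measurable.
- move=> x /=; rewrite in_itv /= andbT => x0.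
  by rewrite lee_fin mulr_ge0 ?expR_ge0 // exprn_ge0 // ltW.
- move=> j x /=; rewrite in_itv /= => /andP[jx xj].
  have x0 : 0 <= x by rewrite ltW // (le_lt_trans _ jx).
  rewrite lee_fin ler_pM ?exprn_ge0 ?expR_ge0 //.
    by rewrite lerXn2r ?nnegrE.
  by rewrite ler_expR lerN2 ltW.
- by move=> j; rewrite [leLHS](lebesgue_unit_itvoc R j).
Qed.

(** On (j+1, j+2] the integrand is at least (j+1)^p exp(-j-2); the shift by one
unit costs the factor exp(2). *)
Lemma moment_series_le (R : realType) (p : nat) :
  (moment_series R p <= (expR 2)%:E * euler_integral R p)%E.
Proof.
rewrite -lee_pdivrMl ?expR_gt0 // -nneseriesZl; last first.
  by move=> j _; rewrite lee_fin mulr_ge0 ?exprn_ge0 ?expR_ge0.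
have -> : (\sum_(j <oo) (((expR 2)^-1)%:E * (j.+1%:R ^+ p * expR (- j%:R))%:E) =
   \sum_(j <oo) ((j.+1%:R ^+ p * expR (- j.+2%:R)) * 1 : R)%:E)%E.
  apply: eq_eseriesr => j _; rewrite -EFinM; congr EFin.
  rewrite mulr1 -expRN mulrCA; congr (_ * _); rewrite -expRD; congr expR.
  by rewrite -[j.+2]addn2 natrD [in RHS]opprD addrC.
apply: (@integral_layers_ge _ _ _ (@lebesgue_measure R) _
  (fun j : nat => `]j.+1%:R, j.+2%:R]%classic : set R) _
  (fun j : nat => j.+1%:R ^+ p * expR (- j.+2%:R)) (fun=> 1)) => //.
- apply/trivIsetP => i j _ _ ij; have /trivIsetP := @trivIset_itvoc R; by apply.
- move=> x [j _] /=; rewrite !in_itv /= andbT => /andP[jx _].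
  by apply: le_lt_trans jx.
- exact: euler_integrand_measurable.
- move=> x /=; rewrite in_itv /= andbT => x0.
  by rewrite lee_fin mulr_ge0 ?expR_ge0 // exprn_ge0 // ltW.
- move=> j x /=; rewrite in_itv /= => /andP[jx xj].
  have x0 : 0 <= x by rewrite ltW // (le_lt_trans _ jx).
  rewrite lee_fin ler_pM ?exprn_ge0 ?expR_ge0 //.
    by rewrite lerXn2r ?nnegrE // ltW.
  by rewrite ler_expR lerN2.
- by move=> j; rewrite [leRHS](lebesgue_unit_itvoc R j.+1).
Qed.

Lemma Gamma_euler_integral (R : realType) (k : nat) :
  (Gamma (2 * k%:R + 1 : R))%:E = euler_integral R (2 * k).
Proof.
have e : (\int[@lebesgue_measure R]_(t in `]0%R, +oo[)
    (t `^ (2 * k%:R + 1 - 1) * expR (- t))%:E)%E = euler_integral R (2 * k).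
  apply: eq_integral => t; rewrite inE /= in_itv /= andbT => t0.
  by rewrite addrK -natrM powR_mulrn // ltW.
rewrite /Gamma /Rintegral e fineK // ge0_fin_numE.
  exact: le_lt_trans (euler_integral_le R _) (moment_series_lty R _).
apply: integral_ge0 => x /=; rewrite in_itv /= andbT => x0.
by rewrite lee_fin mulr_ge0 ?expR_ge0 // exprn_ge0 // ltW.
Qed.

(** * The two moment bounds *)

Lemma lebesgue_bad (R : realType) :
  lebesgue_measure (@rational_in01 R `|` @divergent R) = 0%E.
Proof.
apply/eqP; rewrite eq_le measure_ge0 andbT; apply: (le_trans (lebesgue_subU _ _)).
rewrite lebesgue_divergent adde0 countable_lebesgue_measure0 //.
exact: countable_rational_in01.
Qed.

Lemma not_bad (R : realType) (x : R) : 0 < x < 1 ->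
  ~ (@rational_in01 R `|` @divergent R) x ->
  irrational01 x /\ g_partial x @ \oo --> g x.
Proof.
move=> x01 /not_orP[xQ xD].
have xI : irrational01 x.
  by apply: contrapT => xI; apply: xQ; split; rewrite //= in_itv.
by split => //; move/(divergent_cvgP xI): xD.
Qed.

Lemma lebesgue_g_tail (R : realType) : exists2 A : R, 0 < A & forall y,
  (lebesgue_measure [set x | (0 < x < 1)%R /\ (y <= `|g x|)%R] <= (A * expR (- y))%:E)%E.
Proof.
have [A A0 HA] := lebesgue_tail R; exists (A * expR 1); first by rewrite mulr_gt0 ?expR_gt0.
move=> y.
have -> : A * expR 1 * expR (- y) = A * expR (- (y - 1)).
  by rewrite -mulrA -expRD; congr (_ * expR _); ring.
apply: le_trans (HA (y - 1)).
apply: (@le_trans _ _ (lebesgue_measure (tail (y - 1) `|` (@rational_in01 R `|` @divergent R)))).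
  apply: lebesgue_le => x [x01 yg].
  have [bad|good] := pselect ((@rational_in01 R `|` @divergent R) x); [by right|left].
  have [xI xg] := not_bad x01 good; split => //.
  have [N _ HN] := (@cvgrPdist_lt _ _ _ _ _ _ _).1 xg 1 ltr01.
  have h : `|g x - g_partial x N| < 1 := HN N (leqnn N).
  exists N; have := ler_normB (g x - g_partial x N) (- g_partial x N).
  by rewrite opprK subrK normrN; lra.
by apply: (le_trans (lebesgue_subU _ _)); rewrite lebesgue_bad adde0.
Qed.

Lemma integral_g_upper (R : realType) : exists2 C : R, 0 < C & forall k : nat,
  (\int[@lebesgue_measure R]_(x in `]0%R, 1%R[) (g x ^+ (2 * k))%:E
     <= C%:E * moment_series R (2 * k))%E.
Proof.
have [A A0 HA] := lebesgue_g_tail R; exists A => // k.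
rewrite -nneseriesZl; last by move=> j _; rewrite lee_fin mulr_ge0 ?exprn_ge0 ?expR_ge0.
have -> : (\sum_(j <oo) (A%:E * (j.+1%:R ^+ (2 * k) * expR (- j%:R))%:E) =
   \sum_(j <oo) (j.+1%:R ^+ (2 * k) * (A * expR (- j%:R)) : R)%:E)%E.
  by apply: eq_eseriesr => j _; rewrite -EFinM mulrCA.
pose F (j : nat) : set R := `]0, 1[%classic `&` @g R @^-1` [set z | j%:R <= `|z| < j.+1%:R].
apply: (@integral_layers_le _ _ _ (@lebesgue_measure R) _ F _
  (fun j : nat => j.+1%:R ^+ (2 * k)) (fun j : nat => A * expR (- j%:R))).
- move=> j; apply: measurable_g => //.
  rewrite (_ : [set z | _] = (@Num.norm R R) @^-1` `[j%:R, j.+1%:R[%classic); last first.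
    by apply/seteqP; split => z /=; rewrite in_itv.
  by rewrite -[X in measurable X]setTI; apply: (@normr_measurable R setT).
- apply/trivIsetP => i j _ _ /eqP ij; rewrite -subset0 => x [[_ /= hi] [_ /= hj]].
  by apply: ij; rewrite -(truncn_def hi) -(truncn_def hj).
- apply/seteqP; split => [x x01|x [j _ []]//].
  by exists (Num.trunc `|g x|) => //; split => //=; exact: truncn_itv.
- apply/measurable_EFinP; apply: measurable_funX; exact: measurable_g.
- by move=> x _; rewrite lee_fin exprM exprn_ge0 // sqr_ge0.
- by move=> j; rewrite exprn_ge0.
- move=> j x [_ /= /andP[_ gj]]; rewrite lee_fin.
  have -> : g x ^+ (2 * k) = `|g x| ^+ (2 * k) by rewrite !exprM real_normK ?num_real.
  by rewrite lerXn2r ?nnegrE // ltW.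
- move=> j; apply: le_trans (HA j%:R); apply: lebesgue_le => x [/= x01 /andP[gj _]].
  by split => //; move: x01; rewrite in_itv.
Qed.

Lemma expR1_ge2 (R : realType) : 2 <= expR 1 :> R.
Proof. by have := @expR_ge1Dx R 1; lra. Qed.

(** The relevant branches have n about exp(j), and the sum of 1/n^2 over them is
O(exp(-j)): relative to the scale, the bad set has the density of the tail. *)
Lemma lebesgue_scale_tail (R : realType) (B a : R) (j : nat) : 0 <= a -> (0 < j)%N ->
  (lebesgue_measure (tail B) <= a%:E)%E ->
  (lebesgue_measure [set x : R | [/\ irrational01 x, (expR (- j.+1%:R) < x < expR (- j%:R))%R
     & tail B (gauss_map x)]] <= (4 * a * expR (- j%:R))%:E)%E.
Proof.
move=> a0 j0 Ha; set Q := [set x | _].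
set e := expR j%:R : R; have e2 : 2 <= e.
  by apply: le_trans (expR1_ge2 R) _; rewrite ler_expR ler1n.
have /andP[m0e em0] := truncn_itv (expR_ge0 j%:R : 0 <= e).
set m0 := Num.trunc e in m0e em0.
have m02 : (2 <= m0)%N by rewrite truncn_ge_nat // (le_trans _ e2).
apply: (@le_trans _ _ (0 + \sum_(m0 <= n < (Num.trunc (expR j.+1%:R : R)).+1) a / n%:R ^+ 2)%:E).
  apply: (@lebesgue_gauss_branches _ _ _ (fun=> tail B) (fun=> a)) => //.
  - by apply: leq_trans m02.
  - by move=> x [].
  - by move=> n x [].
  move=> x [xI /andP[jx xj] tx]; right; have [/andP[x0 _] _] := xI.
  split => //; rewrite ltnS; apply/andP; split; apply: le_truncn.
    by rewrite /e -[j%:R]opprK expRN lef_pV2 ?posrE ?expR_gt0 // ltW.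
  by rewrite -[j.+1%:R]opprK expRN lef_pV2 ?posrE ?expR_gt0 // ltW.
rewrite lee_fin add0r; apply: (le_trans (sum_inv_sqr_le _ a0 m02)).
have -> : 4 * a * expR (- j%:R) = a * (4 / e) by rewrite expRN /e; ring.
rewrite ler_wpM2l // ler_pdivrMr ?ltr0n ?(leq_trans _ m02) //.
rewrite mulrAC ler_pdivlMr; last lra.
by move: em0; rewrite -[m0.+1%:R]natr1; lra.
Qed.

(** For [B] with a tail of measure at most 1/16, the points of the scale sent into the tail fill
at most a quarter of exp(-j), out of a scale of length above half of exp(-j).
At the others x G_M(T x) is at most [B], so the functional equation leaves
ln (1/x) up to a constant. *)
Lemma lebesgue_scale_good (R : realType) : exists C0 : nat, forall j : nat, (0 < j)%N ->
  ((expR (- j%:R) / 4)%:E <= lebesgue_measure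
     (`]expR (- j.+1%:R), expR (- j%:R)[%classic `&` [set x : R | (j%:R - C0%:R <= g x)%R]))%E.
Proof.
have [A A0 HA] := lebesgue_tail R.
have [C C0 HC] := g_partial_recursion R.
pose B := Num.max 0 (ln (16 * A)).
have tB : (lebesgue_measure (tail B) <= (16^-1)%:E)%E.
  apply: (le_trans (HA B)); rewrite lee_fin expRN ler_pdivrMr ?expR_gt0 //.
  rewrite ler_pdivlMl // -[16 * A]lnK ?posrE ?mulr_gt0 // ler_expR /B.
  by rewrite le_max lexx orbT.
have B0 : 0 <= B by rewrite /B le_max lexx.
exists (Num.trunc (C + B)).+1 => j j0.
set c0 := (Num.trunc (C + B)).+1%:R : R; have c0E : C + B <= c0 by apply: ltW; exact: truncnS_gt.
set J := `]_, _[%classic; set D := J `&` _.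
set Q := [set x : R | [/\ irrational01 x, (expR (- j.+1%:R) < x < expR (- j%:R))%R
     & tail B (gauss_map x)]].
have JU : J `<=` D `|` ((@rational_in01 R `|` @divergent R) `|` Q).
  move=> x Jx; have /andP[jx xj] : expR (- j.+1%:R) < x < expR (- j%:R).
    by move: Jx; rewrite /J /= in_itv.
  have x01 : 0 < x < 1.
    rewrite (lt_trans (expR_gt0 _) jx) /= (lt_trans xj) // expR_lt1 oppr_lt0 ltr0n //.
  have [bad|good] := pselect ((@rational_in01 R `|` @divergent R) x); first by right; left.
  have [xI xg] := not_bad x01 good.
  have [tx|tx] := pselect (tail B (gauss_map x)).
    by right; right; split => //; rewrite jx.
  left; split => //=.
  have xj' : j%:R <= - ln x.
    rewrite lerNr -[- j%:R]expRK ler_ln ?posrE ?expR_gt0 //; first exact: ltW.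
    by case/andP: x01.
  have [x0 _] := andP x01.
  apply: (cvgr_to_ge xg); exists (Num.trunc x^-1).+1 => // N /= hN.
  have Nx : (0 < Num.trunc (N%:R * x))%N.
    rewrite truncn_gt0 -ler_pdivrMr // mul1r ltW //.
    by apply: (lt_le_trans (truncnS_gt _)); rewrite ler_nat.
  have [_ /(_ Nx)] := HC x xI N.
  have : x * `|g_partial (gauss_map x) (Num.trunc (N%:R * x))| <= B.
    apply: (@le_trans _ _ `|g_partial (gauss_map x) (Num.trunc (N%:R * x))|).
      by rewrite ler_piMl //; case/andP: x01 => _ /ltW.
    rewrite leNgt; apply/negP => h; apply: tx; split; first exact: irrational01_gauss.
    by exists (Num.trunc (N%:R * x)).
  lra.
set e := expR (- j%:R).
have e0 : 0 < e by exact: expR_gt0.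
have eS : expR (- j.+1%:R) = e / expR 1.
  by rewrite -expRB -[j.+1%:R]natr1 opprD.
have muJ : ((e / 2)%:E <= lebesgue_measure J)%E.
  have eh : e / expR 1 <= e / 2.
    by rewrite ler_pM2l // lef_pV2 ?posrE ?expR_gt0 // expR1_ge2.
  rewrite lebesgue_measure_itv /= lte_fin ltr_expR ltrN2 ltr_nat ltnSn -EFinB lee_fin eS -/e.
  lra.
have muQ : (lebesgue_measure Q <= (e / 4)%:E)%E.
  apply: (le_trans (lebesgue_scale_tail _ j0 tB)); first by rewrite invr_ge0.
  by rewrite lee_fin -/e; lra.
have : (lebesgue_measure J <= lebesgue_measure D + lebesgue_measure Q)%E.
  apply: (le_trans (lebesgue_le JU)); apply: (le_trans (lebesgue_subU _ _)).
  rewrite leeD2l //; apply: (le_trans (lebesgue_subU _ _)).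
  by rewrite lebesgue_bad add0e.
move=> /(le_trans muJ) /le_trans /(_ (leeD2l _ muQ)).
have -> : ((e / 2)%:E = (e / 4)%:E + (e / 4)%:E)%E by rewrite -EFinD; congr EFin; field.
by rewrite leeD2rE.
Qed.

Lemma trivIset_scales (R : realType) :
  trivIset setT (fun j : nat => `]expR (- j.+1%:R), expR (- j%:R)[%classic : set R).
Proof.
apply/trivIsetP => i j _ _ /eqP ij; rewrite -subset0 => x [] /=.
rewrite !in_itv /= => /andP[ix xi] /andP[jx xj]; apply: ij; apply/eqP.
have := lt_trans ix xj; have := lt_trans jx xi.
rewrite !ltr_expR !ltrN2 !ltr_nat !ltnS => ij ji.
by rewrite eqn_leq ij ji.
Qed.

(** The scales are shifted by [C0 + 1], so that [g >= j + 1] holds on the j-th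
layer; the shift turns into a constant factor of exp(-j). *)
Lemma integral_g_lower (R : realType) : exists2 c : R, 0 < c & forall k : nat,
  (c%:E * moment_series R (2 * k)
     <= \int[@lebesgue_measure R]_(x in `]0%R, 1%R[) (g x ^+ (2 * k))%:E)%E.
Proof.
have [C0 HC0] := lebesgue_scale_good R.
pose c : R := expR (- C0.+1%:R) / 4.
have c0 : 0 < c by rewrite divr_gt0 ?expR_gt0.
exists c => // k.
rewrite -nneseriesZl; last by move=> j _; rewrite lee_fin mulr_ge0 ?exprn_ge0 ?expR_ge0.
have -> : (\sum_(j <oo) (c%:E * (j.+1%:R ^+ (2 * k) * expR (- j%:R))%:E) =
   \sum_(j <oo) (j.+1%:R ^+ (2 * k) * (expR (- (j + C0.+1)%:R) / 4) : R)%:E)%E.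
  apply: eq_eseriesr => j _; rewrite -EFinM mulrCA natrD opprD expRD /c; congr EFin; ring.
pose J (j : nat) : set R := `]expR (- j.+1%:R), expR (- j%:R)[%classic.
have J01 j : J j `<=` `]0, 1[%classic.
  move=> x; rewrite /J /= !in_itv /= => /andP[h1 h2].
  by rewrite (lt_trans (expR_gt0 _) h1) (lt_le_trans h2) // expR_le1 oppr_le0.
have mg := @measurable_g R.
pose F (i : nat) : set R := J (i + C0.+1)%N `&` [set x : R | ((i + C0.+1)%:R - C0%:R <= g x)%R].
apply: (@integral_layers_ge _ _ _ (@lebesgue_measure R) _ F _
  (fun j : nat => j.+1%:R ^+ (2 * k)) (fun j : nat => expR (- (j + C0.+1)%:R) / 4)).
- exact: measurable_itv.
- move=> j; rewrite /F -[J _](setIidl (J01 _)) -setIA; apply: measurableI; first exact: measurable_itv.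
  have gE : `]0, 1[%classic `&` [set x : R | ((j + C0.+1)%:R - C0%:R <= g x)%R] =
      `]0, 1[%classic `&` @g R @^-1` `[(j + C0.+1)%:R - C0%:R, +oo[%classic.
    by congr setI; apply/seteqP; split => z /=; rewrite in_itv /= andbT.
  by rewrite [X in measurable X]gE; exact: mg.
- apply/trivIsetP => i j _ _ ij; rewrite -subset0 => x [[xi _] [xj _]].
  have /trivIsetP := @trivIset_scales R.
  move=> /(_ (i + C0.+1)%N (j + C0.+1)%N I I); rewrite eqn_add2r => /(_ ij).
  by rewrite -subset0; apply; split.
- by move=> x [j _ [/J01]].
- apply/measurable_EFinP; apply: measurable_funX; exact: mg.
- by move=> x _; rewrite lee_fin exprM exprn_ge0 // sqr_ge0.
- by move=> j; rewrite exprn_ge0.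
- by move=> j; rewrite divr_ge0 ?expR_ge0.
- move=> j x [_ /= gj]; rewrite lee_fin.
  have jg : j.+1%:R <= g x.
    by apply: le_trans gj; rewrite -natrB ?ler_nat; lia.
  by rewrite lerXn2r ?nnegrE // (le_trans _ jg).
- by move=> j; apply: HC0; rewrite addnS.
Qed.

Theorem theorem1p1 (R : realType) :
  exists c1 c2 : R, [/\ 0 < c1, 0 < c2 &
    forall k : nat, (1 <= k)%N ->
      ((c1 * Gamma (2 * k%:R + 1))%:E
         <= \int[@lebesgue_measure R]_(x in `]0%R, 1%R[) (g x ^+ (2 * k))%:E)%E /\
      (\int[@lebesgue_measure R]_(x in `]0%R, 1%R[) (g x ^+ (2 * k))%:E
         <= (c2 * Gamma (2 * k%:R + 1))%:E)%E].
Proof.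
have [c c0 Hc] := integral_g_lower R; have [C C0 HC] := integral_g_upper R.
exists c, (C * expR 2); split => [//||k _]; first by rewrite mulr_gt0 ?expR_gt0.
rewrite !EFinM !Gamma_euler_integral; split.
  by apply: le_trans (Hc k); rewrite lee_pmul2l // euler_integral_le.
apply: (le_trans (HC k)); rewrite -muleA lee_pmul2l //.
exact: moment_series_le.
Qed.
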